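(* Let $k>2$ be an integer and $\Gamma_k$ a non-abelian free group of rank $k$. There exists a quasi-isometric representation $\rho_k:\Gamma_k\to\mathrm{SL}_3(\mathbb{R})$ whose image is Zariski dense in $\mathrm{SL}_3(\mathbb{R})$, such that $\rho_k$ is not in the closure (in $\mathrm{Hom}(\Gamma_k,\mathrm{SL}_3(\mathbb{R}))$) of the set of Anosov representations, and such that $\rho_k$ is not robustly quasi-isometric.
   Context: $\mathrm{Hom}(\Gamma,\mathrm{SL}_3(\mathbb{R}))$ carries the topology of pointwise convergence; a property is robust at $\rho$ if it holds on an open neighborhood of $\rho$. Fix a finite symmetric generating set of $\Gamma$ with word length $|\cdot|$. A representation $\rho:\Gamma\to\mathrm{SL}_3(\mathbb{R})$ is quasi-isometric if it is a quasi-isometric embedding for the word metric and a left-invariant Riemannian metric on $\mathrm{SL}_3(\mathbb{R})$; equivalently, there exist $a\ge1,b\ge0$ with $\log s_1(\rho(\gamma))\ge a^{-1}|\gamma|-b$ for all $\gamma$, where $s_1\ge s_2\ge s_3$ are the singular values. $\rho$ is Anosov if there exist $c,d>0$ with $\log s_1(\rho(\gamma))-\log s_2(\rho(\gamma))\ge c|\gamma|-d$ for all $\gamma\in\Gamma$. *)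

(* Defs.v *)
From HB Require Import structures.
From mathcomp Require Import all_boot all_order all_algebra.
From mathcomp Require Import Rstruct.
From mathcomp Require mpoly.
From Stdlib Require Import Rdefinitions Rpower.
Set Implicit Arguments. Unset Strict Implicit. Unset Printing Implicit Defensive.
Import Order.TTheory GRing.Theory Num.Theory.
Local Open Scope ring_scope.

(* A letter is a free generator a_i (sign false) or its inverse (sign true). *)
Definition letter (k : nat) := ('I_k * bool)%type.

Fixpoint reduced (k : nat) (w : seq (letter k)) : bool :=
  match w with
  | x :: ((y :: _) as t) => ~~ ((x.1 == y.1) && (x.2 != y.2)) && reduced t
  | _ => true
  end.

Definition FG (k : nat) := {w : seq (letter k) | reduced w}.

Definition wlen (k : nat) (g : FG k) : nat := size (sval g).

(* A homomorphism from the free group is determined by (and freely determined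
   by) the images of the free generators; rho : 'I_k -> 'M_3 is in
   Hom(Gamma_k, SL_3(R)) iff every generator image has determinant 1. *)
Definition SL3rep (k : nat) (rho : 'I_k -> 'M[R]_3) : Prop :=
  forall i, \det (rho i) = 1.

Definition evalrep (k : nat) (rho : 'I_k -> 'M[R]_3) (g : FG k) : 'M[R]_3 :=
  \prod_(x <- sval g) (if x.2 then invmx (rho x.1) else rho x.1).

Definition singular_values (A : 'M[R]_3) (s1 s2 s3 : R) : Prop :=
  [/\ s2 <= s1, s3 <= s2, 0 <= s3 &
      char_poly (A^T *m A) =
        ('X - (s1 ^+ 2)%:P) * ('X - (s2 ^+ 2)%:P) * ('X - (s3 ^+ 2)%:P)].

Definition quasi_isometric (k : nat) (rho : 'I_k -> 'M[R]_3) : Prop :=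
  exists a b : R, 1 <= a /\ 0 <= b /\
    forall (g : FG k) (s1 s2 s3 : R), singular_values (evalrep rho g) s1 s2 s3 ->
      (wlen g)%:R / a - b <= ln s1.

Definition anosov (k : nat) (rho : 'I_k -> 'M[R]_3) : Prop :=
  exists c d : R, 0 < c /\ 0 < d /\
    forall (g : FG k) (s1 s2 s3 : R), singular_values (evalrep rho g) s1 s2 s3 ->
      c * (wlen g)%:R - d <= ln s1 - ln s2.

Definition mx_coords (A : 'M[R]_3) : 'I_9 -> R := fun i => mxvec A 0 i.

Definition zariski_dense_image (k : nat) (rho : 'I_k -> 'M[R]_3) : Prop :=
  forall p : mpoly.mpoly 9 R,
    (forall g : FG k, mpoly.meval (mx_coords (evalrep rho g)) p = 0) ->
    forall A : 'M[R]_3, \det A = 1 -> mpoly.meval (mx_coords A) p = 0.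

Definition basic_nbhd (k : nat) (rho : 'I_k -> 'M[R]_3) (F : seq (FG k)) (eps : R)
    (rho' : 'I_k -> 'M[R]_3) : Prop :=
  forall g, g \in F -> forall i j : 'I_3,
    `|evalrep rho' g i j - evalrep rho g i j| < eps.

Definition in_closure (k : nat) (P : ('I_k -> 'M[R]_3) -> Prop)
    (rho : 'I_k -> 'M[R]_3) : Prop :=
  forall (F : seq (FG k)) (eps : R), 0 < eps ->
    exists rho', SL3rep rho' /\ basic_nbhd rho F eps rho' /\ P rho'.

Definition robust (k : nat) (P : ('I_k -> 'M[R]_3) -> Prop)
    (rho : 'I_k -> 'M[R]_3) : Prop :=
  exists (F : seq (FG k)) (eps : R), 0 < eps /\
    forall rho', SL3rep rho' -> basic_nbhd rho F eps rho' -> P rho'.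

(* Main.v *)
Require Import Defs.
From mathcomp Require Import all_boot all_algebra Rstruct.
From Stdlib Require Import Rdefinitions.
From mathcomp Require Import all_order ring lra.
From mathcomp Require mpoly.
Import (canonicals) mpoly.
From Stdlib Require Import Rpower Rtrigo_def Rtrigo1 Rtrigo_calc Rseries SeqProp Rtrigo_reg.
Set Implicit Arguments. Unset Strict Implicit. Unset Printing Implicit Defensive.
Import Order.TTheory GRing.Theory Num.Theory.
Local Open Scope ring_scope.
(* Without the next two commands [%N] no longer denotes [nat_scope], and arguments of type [R]
   are parsed with the operations of Stdlib instead of those of MathComp. *)
Delimit Scope nat_scope with N.
Bind Scope ring_scope with R.

(** Let C be diag(9, R/3) with R the rotation by 2 pi/3, and let d be the boost of ratio 100 in the
    first two coordinates. The generators are the conjugates d^(i-1) C d^(1-i), except that the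
    generator of index 0 is d^(-1) C^T d, the transpose of the one of index 2; the generator of
    index 1 is C itself.

    Quasi-isometry is ping-pong on vectors with growth of the norm: negative powers of C push a
    vector towards its contracted plane, but, R having order 3, only near finitely many directions,
    which stay away from the repelling lines of the powers of d. Since C has a non-real pair of
    eigenvalues, which is an open condition and excludes that C belongs to an Anosov
    representation, rho is not in the closure of Anosov representations.

    For non-robustness, replace the angle 2 pi/3 by 2 pi/3 + pi/(6n). Then C^(3n) rotates the
    contracted plane by a right angle and C^(12n) is a scalar there. Writing z, y for the generators
    of index 0 and 2, the symmetry z = y^T and a tiny shear of y make g = z C^(-3n) y send the axis e
    of C into that plane. Hence f = g^(-1) C^(12n) g fixes the line of e, and C^(-m) f C^m stays
    bounded for m divisible by 12n, although its word length tends to infinity.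

    For Zariski density, the Zariski closure contains the tori generated by C^3 and d C^3 d^(-1);
    degenerating the second one by the first gives elementary unipotents. *)

(** * Matrices of size 3 *)

Notation o0 := (@Ordinal 3 0 isT).
Notation o1 := (@Ordinal 3 1 isT).
Notation o2 := (@Ordinal 3 2 isT).

Lemma ord3_ind (P : 'I_3 -> Prop) : P o0 -> P o1 -> P o2 -> forall i, P i.
Proof.
move=> P0 P1 P2 [[|[|[|i]]] hi] //.
- by rewrite (_ : Ordinal hi = o0) //; apply: val_inj.
- by rewrite (_ : Ordinal hi = o1) //; apply: val_inj.
- by rewrite (_ : Ordinal hi = o2) //; apply: val_inj.
Qed.

Lemma sum_ord3 (V : nmodType) (F : 'I_3 -> V) : \sum_i F i = F o0 + F o1 + F o2.
Proof.
rewrite !big_ord_recl big_ord0 addr0 addrA.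
by congr (_ + _ + _); congr F; apply: val_inj.
Qed.

Definition mx3 (a b c d e f g h i : R) : 'M[R]_3 :=
  \matrix_(r, s) nth 0 (nth [::] [:: [:: a; b; c]; [:: d; e; f]; [:: g; h; i]] r) s.

Definition cv3 (x y z : R) : 'cV[R]_3 := \col_r nth 0 [:: x; y; z] r.


Lemma mx3_eta (A : 'M[R]_3) :
  A = mx3 (A o0 o0) (A o0 o1) (A o0 o2) (A o1 o0) (A o1 o1) (A o1 o2)
          (A o2 o0) (A o2 o1) (A o2 o2).
Proof. by apply/matrixP; do 2![apply: ord3_ind]; rewrite mxE. Qed.

Lemma cv3_eta (v : 'cV[R]_3) : v = cv3 (v o0 0) (v o1 0) (v o2 0).
Proof. by apply/colP; apply: ord3_ind; rewrite mxE. Qed.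

Lemma mx3P (A : 'M[R]_3) : exists a b c d e f g h i, A = mx3 a b c d e f g h i.
Proof. by do 9!eexists; apply: mx3_eta. Qed.

Lemma mx3_mul a b c d e f g h i a' b' c' d' e' f' g' h' i' :
  mx3 a b c d e f g h i *m mx3 a' b' c' d' e' f' g' h' i' =
  mx3 (a * a' + b * d' + c * g') (a * b' + b * e' + c * h') (a * c' + b * f' + c * i')
      (d * a' + e * d' + f * g') (d * b' + e * e' + f * h') (d * c' + e * f' + f * i')
      (g * a' + h * d' + i * g') (g * b' + h * e' + i * h') (g * c' + h * f' + i * i').
Proof. by apply/matrixP; do 2![apply: ord3_ind]; rewrite !mxE sum_ord3 !mxE. Qed.

Lemma mx3_cv3 a b c d e f g h i x y z :
  mx3 a b c d e f g h i *m cv3 x y z =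
  cv3 (a * x + b * y + c * z) (d * x + e * y + f * z) (g * x + h * y + i * z).
Proof. by apply/colP; apply: ord3_ind; rewrite !mxE sum_ord3 !mxE. Qed.

Lemma mx3_scalar x : x%:M = mx3 x 0 0 0 x 0 0 0 x.
Proof. by apply/matrixP; do 2![apply: ord3_ind]; rewrite !mxE. Qed.

Lemma mx3_1 : 1%:M = mx3 1 0 0 0 1 0 0 0 1.
Proof. exact: mx3_scalar. Qed.

Lemma mx3_tr a b c d e f g h i : (mx3 a b c d e f g h i)^T = mx3 a d g b e h c f i.
Proof. by apply/matrixP; do 2![apply: ord3_ind]; rewrite !mxE. Qed.

Lemma mx3_add a b c d e f g h i a' b' c' d' e' f' g' h' i' :
  mx3 a b c d e f g h i + mx3 a' b' c' d' e' f' g' h' i' =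
  mx3 (a + a') (b + b') (c + c') (d + d') (e + e') (f + f') (g + g') (h + h') (i + i').
Proof. by apply/matrixP; do 2![apply: ord3_ind]; rewrite !mxE. Qed.

Lemma mx3_opp a b c d e f g h i :
  - mx3 a b c d e f g h i = mx3 (-a) (-b) (-c) (-d) (-e) (-f) (-g) (-h) (-i).
Proof. by apply/matrixP; do 2![apply: ord3_ind]; rewrite !mxE. Qed.

Lemma mx3_det a b c d e f g h i :
  \det (mx3 a b c d e f g h i) =
  a * (e * i - f * h) - b * (d * i - f * g) + c * (d * h - e * g).
Proof.
rewrite (expand_det_row _ o0) sum_ord3 !mxE /cofactor /=.
rewrite !(expand_det_row _ ord0) !big_ord_recl !big_ord0 !mxE /cofactor !det_mx11 !mxE /=.
rewrite /bump /=; ring.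
Qed.

Lemma mx3_trace a b c d e f g h i : \tr (mx3 a b c d e f g h i) = a + e + i.
Proof. by rewrite /mxtrace sum_ord3 !mxE. Qed.

(** * Frobenius norm and adjugate *)

Definition frob2 (A : 'M[R]_3) : R := \tr (A^T *m A).
Definition sumsq (v : 'cV[R]_3) : R := v o0 0 ^+ 2 + v o1 0 ^+ 2 + v o2 0 ^+ 2.

Lemma sumsq_cv3 x y z : sumsq (cv3 x y z) = x ^+ 2 + y ^+ 2 + z ^+ 2.
Proof. by rewrite /sumsq !mxE. Qed.

Lemma frob2_mx3 a b c d e f g h i : frob2 (mx3 a b c d e f g h i) =
  a ^+ 2 + b ^+ 2 + c ^+ 2 + d ^+ 2 + e ^+ 2 + f ^+ 2 + g ^+ 2 + h ^+ 2 + i ^+ 2.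
Proof. rewrite /frob2 mx3_tr mx3_mul mx3_trace; ring. Qed.

Lemma frob2_ge0 A : 0 <= frob2 A.
Proof.
rewrite (mx3_eta A) frob2_mx3.
by repeat apply: addr_ge0; exact: sqr_ge0.
Qed.

Lemma sumsq_ge0 v : 0 <= sumsq v.
Proof. by rewrite /sumsq; repeat apply: addr_ge0; exact: sqr_ge0. Qed.

Lemma sumsq_eq0 v : sumsq v = 0 -> v = 0.
Proof.
rewrite (cv3_eta v); move: (v _ _) (v _ _) (v _ _) => x y z; rewrite sumsq_cv3 => h.
have := sqr_ge0 x; have := sqr_ge0 y; have := sqr_ge0 z => h2 h1 h0.
have sq0 (t : R) : t ^+ 2 = 0 -> t = 0 by move/eqP; rewrite sqrf_eq0 => /eqP.
have [x0 y0 z0] : [/\ x = 0, y = 0 & z = 0] by split; apply: sq0; lra.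
rewrite x0 y0 z0.
by apply/colP; apply: ord3_ind; rewrite !mxE.
Qed.

Lemma cauchy_schwarz3 (a b c x y z : R) :
  (a * x + b * y + c * z) ^+ 2 <= (a ^+ 2 + b ^+ 2 + c ^+ 2) * (x ^+ 2 + y ^+ 2 + z ^+ 2).
Proof.
rewrite -subr_ge0.
have -> : (a ^+ 2 + b ^+ 2 + c ^+ 2) * (x ^+ 2 + y ^+ 2 + z ^+ 2)
  - (a * x + b * y + c * z) ^+ 2
  = (a * y - b * x) ^+ 2 + (a * z - c * x) ^+ 2 + (b * z - c * y) ^+ 2 by ring.
by repeat apply: addr_ge0; exact: sqr_ge0.
Qed.

Lemma sumsq_mul (A : 'M[R]_3) v : sumsq (A *m v) <= frob2 A * sumsq v.
Proof.
rewrite (mx3_eta A) (cv3_eta v).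
move: (A _ _) (A _ _) (A _ _) (A _ _) (A _ _) (A _ _) (A _ _) (A _ _) (A _ _).
move: (v _ _) (v _ _) (v _ _) => x y z a b c d e f g h i.
rewrite mx3_cv3 frob2_mx3 !sumsq_cv3.
have cs := cauchy_schwarz3; apply: le_trans (lerD (lerD (cs _ _ _ _ _ _) (cs _ _ _ _ _ _)) (cs _ _ _ _ _ _)) _.
by rewrite -!mulrDl !addrA.
Qed.

(** Spelled out entrywise: inversion in SL_3 becomes visibly polynomial, hence continuous, and the
    norm of the adjugate gives the second symmetric function of the squared singular values. *)
Definition adj3 (A : 'M[R]_3) : 'M[R]_3 :=
  mx3 (A o1 o1 * A o2 o2 - A o1 o2 * A o2 o1) (A o0 o2 * A o2 o1 - A o0 o1 * A o2 o2)
      (A o0 o1 * A o1 o2 - A o0 o2 * A o1 o1)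
      (A o1 o2 * A o2 o0 - A o1 o0 * A o2 o2) (A o0 o0 * A o2 o2 - A o0 o2 * A o2 o0)
      (A o0 o2 * A o1 o0 - A o0 o0 * A o1 o2)
      (A o1 o0 * A o2 o1 - A o1 o1 * A o2 o0) (A o0 o1 * A o2 o0 - A o0 o0 * A o2 o1)
      (A o0 o0 * A o1 o1 - A o0 o1 * A o1 o0).

Lemma adj3_mx3 a b c d e f g h i : adj3 (mx3 a b c d e f g h i) =
  mx3 (e * i - f * h) (c * h - b * i) (b * f - c * e)
      (f * g - d * i) (a * i - c * g) (c * d - a * f)
      (d * h - e * g) (b * g - a * h) (a * e - b * d).
Proof. by rewrite /adj3 !mxE. Qed.

Lemma mulmx_adj3 A : A *m adj3 A = (\det A)%:M.
Proof.
have [a [b [c [d [e [f [g [h [i ->]]]]]]]]] := mx3P A.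
rewrite adj3_mx3 mx3_det mx3_mul mx3_scalar; congr mx3; ring.
Qed.

Lemma invmx_adj3 A : \det A = 1 -> invmx A = adj3 A.
Proof.
move=> dA; have uA : A \in unitmx by rewrite unitmxE dA unitr1.
by rewrite -[RHS](mulKmx uA) mulmx_adj3 dA mulmx1.
Qed.

Lemma invmx_eq (A B : 'M[R]_3) : A *m B = 1%:M -> invmx A = B.
Proof.
move=> AB; have [uA _] := mulmx1_unit AB.
by rewrite -[RHS](mulKmx uA) AB mulmx1.
Qed.

Lemma horner_char_poly3 (A : 'M[R]_3) x :
  (char_poly A).[x] = x ^+ 3 - \tr A * x ^+ 2 + \tr (adj3 A) * x - \det A.
Proof.
have -> : (char_poly A).[x] = \det (x%:M - A).
  rewrite /char_poly -horner_evalE -det_map_mx; congr (\det _).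
  by apply/matrixP => i j; rewrite !mxE /= horner_evalE !hornerE; case: (i == j); rewrite /= ?mulr1n ?mulr0n !hornerE.
have [a [b [c [d [e [f [g [h [i ->]]]]]]]]] := mx3P A.
rewrite mx3_scalar mx3_opp mx3_add adj3_mx3 !mx3_trace !mx3_det; ring.
Qed.

Lemma frob2_adj3_gram (A : 'M[R]_3) : \tr (adj3 (A^T *m A)) = frob2 (adj3 A).
Proof.
have [a [b [c [d [e [f [g [h [i ->]]]]]]]]] := mx3P A.
rewrite mx3_tr mx3_mul !adj3_mx3 mx3_trace frob2_mx3; ring.
Qed.

(** * Singular values *)

Lemma poly_eq0_inj (p : {poly R}) (u : nat -> R) :
  injective u -> (forall n, p.[u n] = 0) -> p = 0.
Proof.
move=> inju pu0; apply/eqP/negPn/negP => p0.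
have /(_ (mkseq u (size p))) := max_poly_roots p0.
rewrite mkseq_uniq // size_mkseq ltnn => h; suff: false by []; apply: h => //.
by apply/allP => x /mapP [n _ ->]; rewrite rootE pu0.
Qed.

Lemma natr_inj_R : injective (fun n : nat => n%:R : R).
Proof. by move=> m n /eqP; rewrite eqr_nat => /eqP. Qed.

Lemma poly_horner_inj (p q : {poly R}) : (forall x, p.[x] = q.[x]) -> p = q.
Proof.
move=> pq; apply/eqP; rewrite -subr_eq0; apply/eqP.
by apply: (poly_eq0_inj natr_inj_R) => n; rewrite hornerD hornerN pq subrr.
Qed.

Lemma horner_char_poly_gram (A : 'M[R]_3) x : (char_poly (A^T *m A)).[x] =
  x ^+ 3 - frob2 A * x ^+ 2 + frob2 (adj3 A) * x - (\det A) ^+ 2.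
Proof. by rewrite horner_char_poly3 frob2_adj3_gram det_mulmx det_tr expr2. Qed.

Lemma horner_linear_quadratic (l tau delta x : R) :
  (('X - l%:P) * ('X ^+ 2 - tau *: 'X + delta%:P)).[x] =
  (x - l) * (x ^+ 2 - tau * x + delta).
Proof. by rewrite !hornerE. Qed.

Lemma horner_linear3 (a b c x : R) :
  (('X - a%:P) * ('X - b%:P) * ('X - c%:P)).[x] = (x - a) * (x - b) * (x - c).
Proof. by rewrite !hornerE. Qed.

Lemma singular_values_sums (A : 'M[R]_3) s1 s2 s3 : singular_values A s1 s2 s3 ->
  [/\ s1 ^+ 2 + s2 ^+ 2 + s3 ^+ 2 = frob2 A,
      s1 ^+ 2 * s2 ^+ 2 + s1 ^+ 2 * s3 ^+ 2 + s2 ^+ 2 * s3 ^+ 2 = frob2 (adj3 A) &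
      s1 ^+ 2 * s2 ^+ 2 * s3 ^+ 2 = (\det A) ^+ 2].
Proof.
case=> _ _ _ chA.
have ev x : (x - s1 ^+ 2) * (x - s2 ^+ 2) * (x - s3 ^+ 2) =
    x ^+ 3 - frob2 A * x ^+ 2 + frob2 (adj3 A) * x - (\det A) ^+ 2.
  by rewrite -horner_char_poly_gram chA horner_linear3.
(* Two monic cubics that agree at 0, 1 and -1 have the same coefficients. *)
have := ev 0; have := ev 1; have := ev (-1).
move: (s1 ^+ 2) (s2 ^+ 2) (s3 ^+ 2) (frob2 A) (frob2 (adj3 A)) ((\det A) ^+ 2) => a b c t1 t2 t3.
rewrite !expr0n /= !mulr0 !sub0r expr1n => em ep e0.
have e3 : a * b * c = t3 by lra.
have e1 : a + b + c = t1 by lra.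
by split => //; lra.
Qed.

Lemma frob2_eq0 A : frob2 A = 0 -> A = 0.
Proof.
have [a [b [c [d [e [f [g [h [i ->]]]]]]]]] := mx3P A.
rewrite frob2_mx3 => F0.
have sq0 (t : R) : t ^+ 2 <= 0 -> t = 0.
  by move=> t0; apply/eqP; rewrite -sqrf_eq0 eq_le t0 sqr_ge0.
have := sqr_ge0 a; have := sqr_ge0 b; have := sqr_ge0 c; have := sqr_ge0 d.
have := sqr_ge0 e; have := sqr_ge0 f; have := sqr_ge0 g; have := sqr_ge0 h.
have := sqr_ge0 i => hi hh hg hf he hd hc hb ha.
have [a0 b0 c0 d0] : [/\ a = 0, b = 0, c = 0 & d = 0] by split; apply: sq0; lra.
have [e0 f0 g0 h0] : [/\ e = 0, f = 0, g = 0 & h = 0] by split; apply: sq0; lra.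
have i0 : i = 0 by apply: sq0; lra.
rewrite a0 b0 c0 d0 e0 f0 g0 h0 i0.
by apply/matrixP; do 2![apply: ord3_ind]; rewrite !mxE.
Qed.

Lemma frob2_subZ (X Y : 'M[R]_3) c :
  frob2 (X - c *: Y) = frob2 X - 2 * c * \tr (Y^T *m X) + c ^+ 2 * frob2 Y.
Proof.
have [a0 [b0 [c0 [d0 [e0 [f0 [g0 [h0 [i0 ->]]]]]]]]] := mx3P X.
have [a1 [b1 [c1 [d1 [e1 [f1 [g1 [h1 [i1 ->]]]]]]]]] := mx3P Y.
rewrite -mul_scalar_mx mx3_scalar mx3_tr !mx3_mul mx3_opp mx3_add !frob2_mx3 mx3_trace; ring.
Qed.

Lemma cubic_annihilates (S : 'M[R]_3) l tau delta :
  char_poly S = ('X - l%:P) * ('X ^+ 2 - tau *: 'X + delta%:P) ->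
  (S *m S - tau *: S + delta%:M) *m (S - l%:M) = 0.
Proof.
rewrite mulrC => chS; have := Cayley_Hamilton S; rewrite chS rmorphM /= => <-.
by rewrite !rmorphD !rmorphN /= -mul_polyC rmorphXn rmorphM /= !horner_mx_X !horner_mx_C
  expr2 -mulmxE mul_scalar_mx.
Qed.

(** Eigenvalues of a symmetric matrix are real: with a negative discriminant the quadratic factor
    would be positive definite at [S], so Cayley-Hamilton would leave [S = l%:M], for which that
    factor is [('X - l%:P) ^+ 2], of discriminant 0. *)
Lemma symmetric_quadratic_discr (S : 'M[R]_3) l tau delta : S^T = S ->
  char_poly S = ('X - l%:P) * ('X ^+ 2 - tau *: 'X + delta%:P) ->
  4 * delta <= tau ^+ 2.
Proof.
move=> symS chS; rewrite leNgt; apply/negP => disc.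
have CH := cubic_annihilates chS.
have W0 : S - l%:M = 0.
  apply: frob2_eq0; move: (S - l%:M) CH => W CH.
  have : \tr (W^T *m ((S *m S - tau *: S + delta%:M) *m W)) = 0.
    by rewrite CH mulmx0 linear0.
  rewrite !mulmxDl mulNmx !mulmxDr mulmxN -!scalemxAl -scalemxAr mul_scalar_mx -scalemxAr.
  rewrite !raddfD raddfN /= !mxtraceZ -[\tr (W^T *m W)]/(frob2 W).
  have -> : \tr (W^T *m (S *m S *m W)) = frob2 (S *m W).
    by rewrite /frob2 trmx_mul symS !mulmxA.
  (* Completing the square bounds the quadratic form below by [(delta - tau ^+ 2 / 4) * frob2 W]. *)
  have := frob2_ge0 (S *m W - (tau / 2) *: W); rewrite frob2_subZ.
  have := frob2_ge0 W.
  move: (frob2 W) (frob2 (S *m W)) (\tr _) => n m t n0 h1 h2.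
  have h3 : n * (delta - tau ^+ 2 / 4) <= 0 by lra.
  have h4 : 0 < delta - tau ^+ 2 / 4 by lra.
  by apply/eqP; rewrite eq_le n0 andbT -(pmulr_lle0 _ h4).
have Sl : S = mx3 l 0 0 0 l 0 0 0 l by rewrite -mx3_scalar; apply/eqP; rewrite -subr_eq0 W0.
have ev x : (x - l) ^+ 3 = (x - l) * (x ^+ 2 - tau * x + delta).
  have -> : (x - l) * (x ^+ 2 - tau * x + delta) = (char_poly S).[x] by rewrite chS horner_linear_quadratic.
  rewrite horner_char_poly3 Sl mx3_trace adj3_mx3 mx3_trace mx3_det; ring.
have ev1 := ev (l + 1); have ev2 := ev (l - 1).
have e2 : tau = 2 * l by lra.
have e1 : delta = l ^+ 2 by rewrite e2 in ev1; lra.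
by move: disc; rewrite e1 e2; lra.
Qed.

(** The intermediate value theorem gives one real root, [symmetric_quadratic_discr] splits the
    remaining quadratic, and the alternating signs of the coefficients exclude negative roots. *)
Lemma char_poly_gram_split (A : 'M[R]_3) : exists a b c : R,
  [/\ b <= a, c <= b, 0 <= c &
    char_poly (A^T *m A) = ('X - a%:P) * ('X - b%:P) * ('X - c%:P)].
Proof.
set t1 := frob2 A; set t2 := frob2 (adj3 A); set t3 := (\det A) ^+ 2.
have t10 : 0 <= t1 by exact: frob2_ge0.
have t20 : 0 <= t2 by exact: frob2_ge0.
have t30 : 0 <= t3 by exact: sqr_ge0.
have chE x : (char_poly (A^T *m A)).[x] = x ^+ 3 - t1 * x ^+ 2 + t2 * x - t3.
  exact: horner_char_poly_gram.
have X0 : 0 <= 1 + t1 + t3 by lra.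
have [l _ /rootP] : exists2 l, 0 <= l <= 1 + t1 + t3 & root (char_poly (A^T *m A)) l.
  apply: poly_ivt => //; rewrite !chE; apply/andP; split.
    by rewrite expr0n /= expr0n /=; lra.
  set X := 1 + t1 + t3.
  have -> : X ^+ 3 - t1 * X ^+ 2 + t2 * X - t3 = X ^+ 2 * (1 + t3) + t2 * X - t3.
    by rewrite /X; ring.
  have h1 : 1 <= X ^+ 2 by rewrite /X; nra.
  have h2 : 0 <= t2 * X by apply: mulr_ge0.
  have h3 : 1 * (1 + t3) <= X ^+ 2 * (1 + t3) by apply: ler_wpM2r => //; lra.
  by lra.
rewrite chE => rl.
pose tau := t1 - l; pose delta := t2 - l * tau.
have chS : char_poly (A^T *m A) = ('X - l%:P) * ('X ^+ 2 - tau *: 'X + delta%:P).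
  apply: poly_horner_inj => x; rewrite chE horner_linear_quadratic /delta /tau.
  have -> : t3 = l ^+ 3 - t1 * l ^+ 2 + t2 * l by lra.
  ring.
have D0 : 0 <= tau ^+ 2 - 4 * delta.
  have := symmetric_quadratic_discr _ chS; rewrite trmx_mul trmxK subr_ge0.
  by move/(_ erefl).
pose s := Num.sqrt (tau ^+ 2 - 4 * delta).
have s0 : 0 <= s by exact: sqrtr_ge0.
have ss : s ^+ 2 = tau ^+ 2 - 4 * delta by exact: sqr_sqrtr.
pose r1 := (tau + s) / 2; pose r2 := (tau - s) / 2.
have r12 : r2 <= r1 by rewrite /r1 /r2; lra.
have fac x : (char_poly (A^T *m A)).[x] = (x - l) * (x - r1) * (x - r2).
  rewrite chS horner_linear_quadratic -mulrA; congr (_ * _).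
  have -> : delta = (tau ^+ 2 - s ^+ 2) / 4 by rewrite ss; field.
  by rewrite /r1 /r2; field.
have pos x : (char_poly (A^T *m A)).[x] = 0 -> 0 <= x.
  rewrite chE => rx; rewrite leNgt; apply/negP => x0.
  have h1 : 0 <= x ^+ 2 by exact: sqr_ge0.
  have h2 : x ^+ 3 < 0 by rewrite exprS nmulr_rlt0 // exprn_even_gt0 //= lt_eqF.
  have h3 : 0 <= t1 * x ^+ 2 by exact: mulr_ge0.
  have h4 : t2 * x <= 0 by apply: mulr_ge0_le0 => //; exact: ltW.
  lra.
have l0 : 0 <= l by apply: pos; rewrite fac subrr !mul0r.
have r10 : 0 <= r1 by apply: pos; rewrite fac subrr mulr0 !mul0r.
have r20 : 0 <= r2 by apply: pos; rewrite fac subrr mulr0.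
have [lr2|r2l] := leP l r2.
  by exists r1, r2, l; split => //; apply: poly_horner_inj => x; rewrite fac horner_linear3; ring.
have [lr1|r1l] := leP l r1.
  by exists r1, l, r2; split => //; [exact: ltW|];
    apply: poly_horner_inj => x; rewrite fac horner_linear3; ring.
exists l, r1, r2; split => //; first exact: ltW.
by apply: poly_horner_inj => x; rewrite fac horner_linear3.
Qed.

(** [quasi_isometric] and [anosov] quantify over all triples of singular values, so refuting them
    requires a triple. *)
Lemma singular_values_exist (A : 'M[R]_3) : exists s1 s2 s3, singular_values A s1 s2 s3.
Proof.
have [a [b [c [ba cb c0 chA]]]] := char_poly_gram_split A.
have b0 := le_trans c0 cb; have a0 := le_trans b0 ba.
exists (Num.sqrt a), (Num.sqrt b), (Num.sqrt c); split.
- exact: ler_wsqrtr.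
- exact: ler_wsqrtr.
- exact: sqrtr_ge0.
by rewrite !sqr_sqrtr.
Qed.

(** * Words and growth of singular values *)

Arguments ln x%_ring_scope.

Lemma lnM (x y : R) : 0 < x -> 0 < y -> ln (x * y) = ln x + ln y.
Proof. by move=> /RltP x0 /RltP y0; exact: ln_mult. Qed.

Lemma ler_ln (x y : R) : 0 < x -> x <= y -> ln x <= ln y.
Proof.
move=> x0; rewrite le_eqVlt => /predU1P [-> //|xy].
by apply/RleP/RIneq.Rlt_le/ln_increasing; exact/RltP.
Qed.

Lemma ln1R : ln 1 = 0. Proof. exact: ln_1. Qed.

Lemma lnX (x : R) n : 0 < x -> ln (x ^+ n) = n%:R * ln x.
Proof.
move=> x0; elim: n => [|n IHn]; first by rewrite expr0 mul0r ln1R.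
by rewrite exprS lnM ?exprn_gt0 // IHn -addn1 natrD; ring.
Qed.

Lemma ln_gt0 (x : R) : 1 < x -> 0 < ln x.
Proof. by move=> x1; rewrite -ln1R; apply/RltP/ln_increasing; exact/RltP. Qed.

Lemma ln_le_self (x : R) : 0 < x -> ln x <= x.
Proof.
move=> x0; have h := exp_ineq1_le (ln x).
have e : Rtrigo_def.exp (ln x) = x by apply: exp_ln; exact/RltP.
have {}h : 1 + ln x <= Rtrigo_def.exp (ln x) by apply/RleP.
by rewrite e in h; lra.
Qed.

Lemma frob2_mul (A B : 'M[R]_3) : frob2 (A *m B) <= frob2 A * frob2 B.
Proof.
have [a [b [c [d [e [f [g [h [i ->]]]]]]]]] := mx3P A.
have [a' [b' [c' [d' [e' [f' [g' [h' [i' ->]]]]]]]]] := mx3P B.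
rewrite mx3_mul !frob2_mx3.
have cs := cauchy_schwarz3.
have s3 (x1 x2 x3 x4 x5 x6 x7 x8 x9 y1 y2 y3 y4 y5 y6 y7 y8 y9 : R) :
  x1 <= y1 -> x2 <= y2 -> x3 <= y3 -> x4 <= y4 -> x5 <= y5 -> x6 <= y6 ->
  x7 <= y7 -> x8 <= y8 -> x9 <= y9 ->
  x1 + x2 + x3 + x4 + x5 + x6 + x7 + x8 + x9 <= y1 + y2 + y3 + y4 + y5 + y6 + y7 + y8 + y9.
  by move=> *; lra.
apply: le_trans (s3 _ _ _ _ _ _ _ _ _ _ _ _ _ _ _ _ _ _ (cs _ _ _ _ _ _) (cs _ _ _ _ _ _)
  (cs _ _ _ _ _ _) (cs _ _ _ _ _ _) (cs _ _ _ _ _ _) (cs _ _ _ _ _ _) (cs _ _ _ _ _ _)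
  (cs _ _ _ _ _ _) (cs _ _ _ _ _ _)) _.
rewrite le_eqVlt; apply/orP; left; apply/eqP; ring.
Qed.

Lemma frob2Z c (A : 'M[R]_3) : frob2 (c *: A) = c ^+ 2 * frob2 A.
Proof.
have [a [b [c' [d [e [f [g [h [i ->]]]]]]]]] := mx3P A.
rewrite -mul_scalar_mx mx3_scalar mx3_mul !frob2_mx3; ring.
Qed.

Lemma frob2_subr_le (A B : 'M[R]_3) : frob2 (A - B) <= 2 * frob2 A + 2 * frob2 B.
Proof.
have := frob2_ge0 (A - (-1) *: B); rewrite frob2_subZ => h.
have := frob2_subZ A B 1; rewrite scale1r => ->; lra.
Qed.

Section SingularValueBounds.
Variables (A : 'M[R]_3) (s1 s2 s3 : R) (sv : singular_values A s1 s2 s3).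

Lemma sqr_s1_le_frob2 : s1 ^+ 2 <= frob2 A.
Proof.
have [<- _ _] := singular_values_sums sv.
by rewrite -addrA lerDl addr_ge0 ?sqr_ge0.
Qed.

Lemma s2_ge0 : 0 <= s2. Proof. by case: sv => _ s32 s30 _; exact: le_trans s32. Qed.

Lemma s1_ge0 : 0 <= s1. Proof. by case: sv => s21 _ _ _; exact: le_trans s2_ge0 s21. Qed.

Lemma sqr_singular_order : s2 ^+ 2 <= s1 ^+ 2 /\ s3 ^+ 2 <= s2 ^+ 2.
Proof.
case: sv => s21 s32 s30 _; have s20 := s2_ge0; have s10 := s1_ge0.
by split; rewrite ler_sqr.
Qed.

Lemma frob2_le_s1 : frob2 A <= 3 * s1 ^+ 2.
Proof.
have [<- _ _] := singular_values_sums sv; have [h1 h2] := sqr_singular_order; lra.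
Qed.

(** In determinant 1 this bounds [s1 * s2] below by the norm of the inverse. *)
Lemma frob2_adj3_le_s1s2 : frob2 (adj3 A) <= 3 * (s1 * s2) ^+ 2.
Proof.
have [_ <- _] := singular_values_sums sv; have [h1 h2] := sqr_singular_order.
have := sqr_ge0 s3; have := sqr_ge0 s2; have := sqr_ge0 s1; rewrite exprMn.
move: (s1 ^+ 2) (s2 ^+ 2) (s3 ^+ 2) h1 h2 => a b c ba cb a0 b0 c0.
have : a * c <= a * b by exact: ler_wpM2l.
have : b * c <= b * a by apply: ler_wpM2l => //; exact: le_trans ba.
lra.
Qed.

Lemma s1s2_gt0 : \det A = 1 -> 0 < s1 /\ 0 < s2.
Proof.
move=> dA; have [_ _] := singular_values_sums sv; rewrite dA expr1n => e.
by split; rewrite lt_neqAle ?s1_ge0 ?s2_ge0 andbT; apply/eqP => z; move: e;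
  rewrite -z expr0n /= ?mulr0 ?mul0r => /eqP; rewrite eq_sym oner_eq0.
Qed.
End SingularValueBounds.

Section Words.
Variables (k : nat) (rho : 'I_k -> 'M[R]_3).

Definition letter_mx (x : letter k) : 'M[R]_3 :=
  if x.2 then invmx (rho x.1) else rho x.1.
Definition word_mx (w : seq (letter k)) : 'M[R]_3 := \prod_(x <- w) letter_mx x.

Lemma word_mx_nil : word_mx [::] = 1%:M. Proof. exact: big_nil. Qed.

Lemma word_mx_cons x w : word_mx (x :: w) = letter_mx x *m word_mx w.
Proof. exact: big_cons. Qed.

Lemma word_mx_cat w1 w2 : word_mx (w1 ++ w2) = word_mx w1 *m word_mx w2.
Proof. exact: big_cat. Qed.

Lemma word_mx_nseq n x : word_mx (nseq n x) = letter_mx x ^+ n.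
Proof. by elim: n => [|n IHn]; [exact: word_mx_nil|rewrite /= word_mx_cons IHn exprS]. Qed.

Lemma reduced_nseq_cat n x (w : seq (letter k)) :
  reduced w -> (if w is y :: _ then ~~ ((x.1 == y.1) && (x.2 != y.2)) else true) ->
  reduced (nseq n x ++ w).
Proof.
move=> rw hw; elim: n => [|n IHn] //=.
by case: n IHn => [|n] /= IHn; [case: w rw hw {IHn} => //= y w -> ->|rewrite eqxx eqxx IHn].
Qed.

Lemma reduced_cons x (w : seq (letter k)) :
  reduced w -> (if w is y :: _ then ~~ ((x.1 == y.1) && (x.2 != y.2)) else true) ->
  reduced (x :: w).
Proof. by case: w => //= y w rw ->. Qed.

Lemma reduced_nseq n (x : letter k) : reduced (nseq n x).
Proof. by rewrite -[nseq n x]cats0; exact: reduced_nseq_cat. Qed.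

Definition word (w : seq (letter k)) (rw : reduced w) : FG k := exist _ w rw.

Lemma det_letter_mx x : SL3rep rho -> \det (letter_mx x) = 1.
Proof. by move=> sl; rewrite /letter_mx; case: x.2; rewrite ?det_inv sl ?invr1. Qed.

Lemma det_word_mx w : SL3rep rho -> \det (word_mx w) = 1.
Proof.
move=> sl; elim: w => [|x w IHw]; first by rewrite word_mx_nil det1.
by rewrite word_mx_cons det_mulmx det_letter_mx // IHw mulr1.
Qed.

Lemma unitmx_rep i : SL3rep rho -> rho i \in unitmx.
Proof. by move=> sl; rewrite unitmxE sl unitr1. Qed.

(** Since [s1 ^+ 2] is at least a third of [frob2], exponential growth of the norm is linear growth
    of [ln s1]. *)
Lemma quasi_isometric_frob2 (K B : R) : 0 < K -> 1 < B ->
  (forall g, K * B ^+ wlen g <= frob2 (evalrep rho g)) -> quasi_isometric rho.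
Proof.
move=> K0 B1 growth; have B0 : 0 < B by lra.
have l2 : 0 < ln B / 2 by rewrite divr_gt0 // ln_gt0.
(* The slope [ln B / 2] would do; adding 1 to its inverse ensures [1 <= a]. *)
exists (1 + (ln B / 2)^-1), (`|ln (K / 3)| / 2); split; first by rewrite lerDl invr_ge0 ltW.
split; first by rewrite divr_ge0.
move=> g s1 s2 s3 sv; have := growth g; have := frob2_le_s1 sv; have := s1_ge0 sv.
move: (wlen g) (frob2 _) => n F s10 F1 F2.
have Bn : 0 < B ^+ n by apply: exprn_gt0.
have KB : 0 < K / 3 * B ^+ n by apply: mulr_gt0 => //; lra.
have low : K / 3 * B ^+ n <= s1 ^+ 2 by lra.
have s1p : 0 < s1.
  by rewrite lt_neqAle s10 andbT; apply/eqP => z; move: low; rewrite -z expr0n /=; lra.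
have := ler_ln KB low.
rewrite lnM // ?divr_gt0 // (lnX n) // (lnX 2) //.
move: (ln B) l2 (ln s1) (ln (K / 3)) => t t0 u v h.
have tn : n%:R / (1 + (t / 2)^-1) <= n%:R * (t / 2).
  apply: ler_wpM2l => //; rewrite -[leRHS]invrK lef_pV2 ?posrE ?invr_gt0 //; first by lra.
  by apply: ltr_wpDl => //; rewrite invr_gt0.
have := ler_norm (- v); rewrite normrN; lra.
Qed.

Lemma not_quasi_isometric_frob2 (u : nat -> FG k) (C : R) : SL3rep rho ->
  (forall j : nat, (j <= wlen (u j))%N) -> (forall j, frob2 (evalrep rho (u j)) <= C) ->
  ~ quasi_isometric rho.
Proof.
move=> sl len bnd [a [b [a1 [b0 qi]]]].
(* Chosen so that [B / a - b = 1 + C], a bound for [s1] and thus for [ln s1]. *)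
pose B := a * (1 + C + b); pose j := Num.bound `|B|.
have Bj : B < j%:R by apply: le_lt_trans (ler_norm _) (archi_boundP (normr_ge0 B)).
have [s1 [s2 [s3 sv]]] := singular_values_exist (evalrep rho (u j)).
have := qi _ _ _ _ sv; have := sqr_s1_le_frob2 sv.
have [s10 _] := s1s2_gt0 sv (det_word_mx _ sl).
have ls := ln_le_self s10; have := bnd j; move: (frob2 _) (ln s1) ls => F t ts FC sF h.
have s1C : s1 <= 1 + C by have := sqr_ge0 (s1 - 1); rewrite sqrrB1; lra.
have : j%:R / a <= (wlen (u j))%:R / a by apply: ler_wpM2r; rewrite ?invr_ge0 ?ler_nat //; lra.
have : B / a < j%:R / a by rewrite ltr_pM2r // invr_gt0; lra.
have -> : B / a = 1 + C + b by rewrite /B mulrAC divff ?mul1r //; lra.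
lra.
Qed.

End Words.

(** * Non-real eigenvalues and Anosov representations *)

(* [y_(n+1)^2 - tau y_n y_(n+1) + r y_n^2] is multiplied by [r] at each step of
   the recurrence [y_(n+2) = tau y_(n+1) - r y_n], and it is positive definite. *)
Lemma elliptic_recurrence_bound (Y : nat -> 'M[R]_3) (tau r : R) :
  tau ^+ 2 < 4 * r -> (forall n, Y n.+2 = tau *: Y n.+1 - r *: Y n) ->
  exists2 K, 0 <= K & forall n, frob2 (Y n) <= K * r ^+ n.
Proof.
move=> disc rec; have r0 : 0 < r by have := sqr_ge0 tau; lra.
pose E n := frob2 (Y n.+1) - tau * \tr ((Y n)^T *m Y n.+1) + r * frob2 (Y n).
have ES n : E n = E 0%N * r ^+ n.
  elim: n => [|n IHn]; first by rewrite expr0 mulr1.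
  rewrite exprSr mulrA -IHn /E rec frob2_subZ frob2Z.
  rewrite mulmxBr -!scalemxAr raddfB /= !mxtraceZ -[\tr ((Y n.+1)^T *m Y n.+1)]/(frob2 _).
  rewrite -(mxtrace_tr ((Y n.+1)^T *m Y n)) trmx_mul trmxK; ring.
have d0 : 0 < r - tau ^+ 2 / 4 by lra.
have low n : (r - tau ^+ 2 / 4) * frob2 (Y n) <= E n.
  by have := frob2_ge0 (Y n.+1 - (tau / 2) *: Y n); rewrite frob2_subZ /E; lra.
exists (E 0%N / (r - tau ^+ 2 / 4)).
  rewrite divr_ge0 ?(ltW d0) //; apply: le_trans (low 0%N).
  by apply: mulr_ge0; [exact: ltW|exact: frob2_ge0].
by move=> n; rewrite mulrAC ler_pdivlMr // -ES mulrC.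
Qed.

(** Split space into the kernels of the coprime factors [q] and [w] of the characteristic
    polynomial. On the image of [w] the powers obey the recurrence of [elliptic_recurrence_bound];
    on the image of [q] they are the scalars [l ^+ n]. *)
Lemma elliptic_power_bound (C : 'M[R]_3) (l tau r : R) :
  char_poly C = ('X - l%:P) * ('X ^+ 2 - tau *: 'X + r%:P) ->
  tau ^+ 2 < 4 * r -> l ^+ 2 <= r ->
  exists2 K, 0 <= K & forall n, frob2 (C ^+ n) <= K * r ^+ n.
Proof.
move=> chC disc lr; pose P := horner_mx C.
have PM p p' : P p *m P p' = P (p * p') by rewrite /P rmorphM.
have PX n : C ^+ n = P ('X ^+ n) by rewrite /P rmorphXn /= horner_mx_X.
have PZ a p : a *: P p = P (a%:P * p) by rewrite -PM /P horner_mx_C mul_scalar_mx.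
pose w : {poly R} := 'X - l%:P; pose q : {poly R} := 'X ^+ 2 - tau%:P * 'X + r%:P.
pose v : {poly R} := 'X + l%:P - tau%:P.
have annih p : P (p * (w * q)) = 0.
  by rewrite -PM; have := Cayley_Hamilton C; rewrite chC -mul_polyC -/w -/q -/P => ->; rewrite mulmx0.
have [K1 K10 bW] : exists2 K, 0 <= K & forall n, frob2 (C ^+ n *m P w) <= K * r ^+ n.
  apply: (elliptic_recurrence_bound disc) => n.
  apply/eqP; rewrite -subr_eq0 -(annih ('X ^+ n)) !PX !PM !PZ /P -!rmorphB; apply/eqP.
  by congr (horner_mx C _); rewrite /q /w !exprS; ring.
have CQ n : C ^+ n *m P q = l ^+ n *: P q.
  elim: n => [|n IHn]; first by rewrite expr0 mul1mx scale1r.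
  rewrite exprSr -mulmxE -mulmxA.
  have -> : C *m P q = l *: P q.
    apply/eqP; rewrite -subr_eq0 -(annih 1) -{1}[C]expr1 PX PM PZ /P -rmorphB; apply/eqP.
    by congr (horner_mx C _); rewrite /w; ring.
  by rewrite -scalemxAr IHn scalerA -exprS.
(* This is [q.[l]], positive because [q] has no real root; the Bezout relation is
   [d = q - w * v]. *)
pose d := r + l ^+ 2 - l * tau.
have d0 : 0 < d by have := sqr_ge0 (l - tau / 2); rewrite /d; lra.
have split1 : d *: (1%:M : 'M_3) = P q - P w *m P v.
  have -> : 1%:M = P 1 by symmetry; exact: (rmorph1 (horner_mx C)).
  rewrite PM PZ /P -rmorphB; congr (horner_mx C _).
  by rewrite /d polyCB polyCD !polyCM /q /w /v; ring.
have d2 : 0 < d ^+ 2 by exact: exprn_gt0.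
exists ((2 * frob2 (P q) + 2 * (K1 * frob2 (P v))) / d ^+ 2).
  by rewrite divr_ge0 ?(ltW d2) // addr_ge0 ?mulr_ge0 ?frob2_ge0.
move=> n; have dC : d *: (C ^+ n) = l ^+ n *: P q - C ^+ n *m P w *m P v.
  by rewrite -CQ -mulmxA -mulmxBr -split1 -scalemxAr mulmx1.
rewrite mulrAC ler_pdivlMr // mulrC -frob2Z dC.
apply: le_trans (frob2_subr_le _ _) _; rewrite frob2Z -exprM mulnC exprM.
have r0 : 0 <= r by apply: le_trans lr; exact: sqr_ge0.
have h1 : (l ^+ 2) ^+ n * frob2 (P q) <= r ^+ n * frob2 (P q).
  by apply: ler_wpM2r; [exact: frob2_ge0|rewrite lerXn2r ?nnegrE ?sqr_ge0].
have h2 : frob2 (C ^+ n *m P w *m P v) <= K1 * r ^+ n * frob2 (P v).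
  by apply: le_trans (frob2_mul _ _) _; apply: ler_wpM2r; rewrite ?frob2_ge0.
lra.
Qed.

(** If the pair were not real, both its members would have squared modulus [l^-1]. For the n-th
    power of the inverse generator, [s1 ^+ 2] is then at most of order [l^-1 ^+ n], while [s1 * s2],
    comparable to the norm of the n-th power of the generator, is at least of that order. So
    [s1 / s2] stays bounded while the word length grows. *)
Lemma anosov_hyperbolic (k : nat) (rho : 'I_k -> 'M[R]_3) i (l tau : R) : SL3rep rho ->
  char_poly (invmx (rho i)) = ('X - l%:P) * ('X ^+ 2 - tau *: 'X + (l^-1)%:P) ->
  0 < l -> l <= 1 -> anosov rho -> 4 / l <= tau ^+ 2.
Proof.
move=> sl chC l0 l1 [c [e [c0 [e0 an]]]]; rewrite leNgt; apply/negP => disc.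
set C := invmx (rho i) in chC; pose B := rho i.
have uB : B \in unitmx by exact: unitmx_rep.
have lV : l ^+ 2 <= l^-1.
  have lV1 : 1 <= l^-1 by rewrite invf_ge1.
  by apply: le_trans lV1; rewrite expr_le1 // ltW.
have [K K0 up] := elliptic_power_bound chC disc lV.
have low n : (l^-1 ^+ n) ^+ 2 <= frob2 (B ^+ n).
  have rl : root (char_poly C) l by rewrite chC rootM rootE !hornerE subrr eqxx.
  (* [eigenvalueP] yields a row eigenvector; the transpose is used to obtain a column
     eigenvector. *)
  have : \det (C - l%:M)^T = 0.
    apply/eqP; rewrite det_tr; move: rl; rewrite -eigenvalue_root_char => /eigenvalueP [v vC v0].
    by apply/det0P; exists v => //; rewrite mulmxBr vC mul_mx_scalar subrr.
  move/eqP/det0P => [v v0 /(congr1 trmx)]; rewrite trmx_mul trmxK trmx0 mulmxBl mul_scalar_mx.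
  move/eqP; rewrite subr_eq0 => /eqP Cv.
  have Bv : B *m v^T = l^-1 *: v^T.
    rewrite -[in RHS](mulKVmx uB v^T) -/C Cv -scalemxAr scalerA mulVf ?scale1r //.
    exact: lt0r_neq0.
  have Bnv : B ^+ n *m v^T = l^-1 ^+ n *: v^T.
    elim: n => [|n IHn]; first by rewrite expr0 mul1mx scale1r.
    by rewrite exprSr -mulmxE -mulmxA Bv -scalemxAr IHn scalerA exprS.
  have := sumsq_mul (B ^+ n) v^T; rewrite Bnv.
  have -> a u : sumsq (a *: u) = a ^+ 2 * sumsq u by rewrite /sumsq !mxE !exprMn !mulrDr.
  rewrite ler_pM2r // lt_neqAle sumsq_ge0 andbT eq_sym; apply/eqP => /sumsq_eq0 v00.
  by move: v0; rewrite -[v]trmxK v00 trmx0 eqxx.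
(* Obtained by writing [ln s1 - ln s2] as [2 * ln s1 - ln (s1 * s2)]; the contributions of
   [l^-1 ^+ n] cancel. *)
pose M := ln (3 * (K + 1)) / 2 + ln (K + 1) / 2.
have main n : c * n%:R - e <= M.
  pose g : FG k := word (reduced_nseq n (i, true)).
  have gE : evalrep rho g = C ^+ n by exact: word_mx_nseq.
  have [s1 [s2 [s3 sv]]] := singular_values_exist (evalrep rho g).
  have dg : \det (evalrep rho g) = 1 by exact: det_word_mx.
  have [s10 s20] := s1s2_gt0 sv dg.
  have := an _ _ _ _ sv; rewrite /wlen /= size_nseq => h; apply: le_trans h _.
  have h1 := sqr_s1_le_frob2 sv; have h2 := frob2_adj3_le_s1s2 sv.
  rewrite -invmx_adj3 // gE in h2; rewrite gE in h1.
  have iC : invmx (C ^+ n) = B ^+ n.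
    apply: invmx_eq; rewrite mulmxE -exprMn_comm; last by rewrite /GRing.comm -!mulmxE mulVmx // mulmxV.
    by rewrite -mulmxE mulVmx // expr1n.
  rewrite iC in h2.
  pose r := l^-1 ^+ n; have r0 : 0 < r by rewrite exprn_gt0 // invr_gt0.
  have K1 : 0 < K + 1 by lra.
  have {}h1 : s1 ^+ 2 <= (K + 1) * r by have := up n; rewrite -/r; nra.
  have {}h2 : r ^+ 2 <= 3 * (s1 * s2) ^+ 2 by apply: le_trans (low n) h2.
  have s12 : 0 < s1 * s2 by exact: mulr_gt0.
  have := ler_ln (exprn_gt0 2 s10) h1.
  rewrite lnX // lnM // => a1.
  have := ler_ln (exprn_gt0 2 r0) h2.
  rewrite lnX // lnM ?exprn_gt0 // lnX // lnM // => a2.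
  rewrite /M lnM //; lra.
pose j := Num.bound `|(M + e) / c|.
have : (M + e) / c < j%:R by apply: le_lt_trans (ler_norm _) (archi_boundP (normr_ge0 _)).
by rewrite ltr_pdivrMr // mulrC => h; have := main j; lra.
Qed.

Lemma cubic_factor (S : 'M[R]_3) l : root (char_poly S) l ->
  char_poly S = ('X - l%:P) * ('X ^+ 2 - (\tr S - l) *: 'X +
    (\tr (adj3 S) - l * (\tr S - l))%:P).
Proof.
move/rootP; rewrite horner_char_poly3 => rl; apply: poly_horner_inj => x.
rewrite horner_char_poly3 horner_linear_quadratic.
have -> : \det S = l ^+ 3 - \tr S * l ^+ 2 + \tr (adj3 S) * l by lra.
ring.
Qed.

(* The numbers are those of the inverse of [loxo 9 (1 / 3) (2 pi / 3)], which has the eigenvalue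
   [1 / 9] and a conjugate pair of modulus [3]. *)
Lemma perturbed_cubic_root (t1 t2 : R) :
  26 / 3 - 1 / 30 <= t1 -> t1 <= 26 / 3 + 1 / 30 ->
  - (26 / 9) - 1 / 30 <= t2 -> t2 <= - (26 / 9) + 1 / 30 ->
  (1 / 20) ^+ 3 - t2 * (1 / 20) ^+ 2 + t1 * (1 / 20) - 1 <= 0 /\
  0 <= (1 / 5) ^+ 3 - t2 * (1 / 5) ^+ 2 + t1 * (1 / 5) - 1.
Proof. by move=> *; split; lra. Qed.

(** With [l] at most 1/5 and [t - l] between -4 and 0 the product is at most 16/5. This keeps the
    discriminant of the quadratic factor in [cubic_factor] negative. *)
Lemma perturbed_discr_lt (l t : R) : 1 / 20 <= l -> l <= 1 / 5 ->
  - (26 / 9) - 1 / 30 <= t -> t <= - (26 / 9) + 1 / 30 -> (t - l) ^+ 2 * l < 4.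
Proof.
move=> l1 l2 h1 h2; have a1 : t - l <= 0 by lra.
have a2 : - 4 <= t - l by lra.
move: (t - l) a1 a2 => u u1 u2.
have u16 : u ^+ 2 <= 16 by clear -u1 u2; nra.
have : u ^+ 2 * l <= 16 * l by apply: ler_wpM2r => //; clear -l1; lra.
by clear -l2; lra.
Qed.

Lemma trace_close (A B : 'M[R]_3) : (forall a b, `|A a b - B a b| < 1 / 90) ->
  \tr B - 1 / 30 <= \tr A /\ \tr A <= \tr B + 1 / 30.
Proof.
move=> h; rewrite /mxtrace !sum_ord3.
have := h o0 o0; have := h o1 o1; have := h o2 o2; rewrite !ltr_norml.
by move=> /andP [? ?] /andP [? ?] /andP [? ?]; split; lra.
Qed.

(** The traces of a generator and of its inverse determine the characteristic polynomial in SL_3.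
    Controlling these two words preserves a root in [1/20, 1/5] and a non-real pair, against
    [anosov_hyperbolic]. *)
Lemma not_in_closure_anosov (k : nat) (rho : 'I_k -> 'M[R]_3) i : SL3rep rho ->
  \tr (rho i) = 26 / 3 -> \tr (invmx (rho i)) = - (26 / 9) ->
  ~ in_closure (@anosov k) rho.
Proof.
move=> sl t1 t2 cl.
pose g1 : FG k := word (reduced_nseq 1 (i, false)).
pose g2 : FG k := word (reduced_nseq 1 (i, true)).
(* Three diagonal entries, each within 1/90, keep a trace within the tolerance 1/30. *)
have e0 : 0 < 1 / 90 :> R by lra.
have [rho' [sl' [nb an]]] := cl [:: g1; g2] _ e0.
have ev1 r : evalrep r g1 = r i by exact: big_seq1.
have ev2 r : evalrep r g2 = invmx (r i) by exact: big_seq1.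
have g2in : g2 \in [:: g1; g2] by rewrite !inE eqxx orbT.
have nb1 := nb g1 (mem_head _ _); have nb2 := nb g2 g2in.
rewrite !ev1 in nb1; rewrite !ev2 in nb2.
have [c3 c4] := trace_close nb1; have [c1 c2] := trace_close nb2.
rewrite t1 in c3 c4; rewrite t2 in c1 c2; set C := invmx (rho' i) in c1 c2.
have dC : \det C = 1 by rewrite det_inv sl' invr1.
have aC : adj3 C = rho' i by rewrite -invmx_adj3 // invmxK.
have [f1 f2] := perturbed_cubic_root c3 c4 c1 c2.
have [l /andP [l1 l2] rl] : exists2 l, 1 / 20 <= l <= 1 / 5 & root (char_poly C) l.
  apply: poly_ivt; first by clear; lra.
  by rewrite !horner_char_poly3 aC dC f1 f2.
have l0 : 0 < l by clear -l1; lra.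
have chC := cubic_factor rl.
have cl1 : \tr (adj3 C) - l * (\tr C - l) = l^-1.
  move/rootP: rl; rewrite horner_char_poly3 dC => h.
  by apply: (mulfI (lt0r_neq0 l0)); rewrite mulfV ?lt0r_neq0 //; clear -h; lra.
rewrite cl1 in chC; have := anosov_hyperbolic sl' chC l0 _ an.
have -> : l <= 1 by clear -l2; lra.
by move/(_ isT); rewrite ler_pdivrMr // leNgt perturbed_discr_lt.
Qed.

(** * Ping-pong *)

(** The cones are parametrized by a scale and relative coordinates; this supplies the relative
    coordinates of an image vector. *)
Lemma ratio_bound (e u y : R) : 0 < u -> - (e * u) <= y -> y <= e * u ->
  exists eta, [/\ - e <= eta, eta <= e & y = u * eta].
Proof.
move=> u0 h1 h2; exists (y / u); split.
- by rewrite ler_pdivlMr // mulNr.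
- by rewrite ler_pdivrMr.
- by rewrite mulrCA divff ?mulr1 // lt0r_neq0.
Qed.

Lemma sqr_le_sum3 (m p q r : R) : m = p ^+ 2 -> m <= p ^+ 2 + q ^+ 2 + r ^+ 2.
Proof. by move=> ->; rewrite -addrA lerDl addr_ge0 ?sqr_ge0. Qed.

(* The dilation [p] on the first axis and [q] times a rotation by [+- 2 pi / 3] on the other
   two coordinates, [T] being the sine of the angle. *)
Definition rotdil (p q T : R) : 'M[R]_3 :=
  mx3 p 0 0 0 (- (q / 2)) (- (q * T)) 0 (q * T) (- (q / 2)).

(* A Lorentz boost: [(1, 1, 0)] and [(1, -1, 0)] have eigenvalues [q] and [q^-1]. *)
Definition boost (q : R) : 'M[R]_3 :=
  mx3 ((q + q^-1) / 2) ((q - q^-1) / 2) 0 ((q - q^-1) / 2) ((q + q^-1) / 2) 0 0 0 1.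

Lemma boostM q q' : q != 0 -> q' != 0 -> boost q *m boost q' = boost (q * q').
Proof. by move=> q0 q'0; rewrite mx3_mul; congr mx3; field; rewrite ?q0 ?q'0. Qed.

Lemma boost1 : boost 1 = 1%:M.
Proof. by rewrite mx3_1; congr mx3; field. Qed.

Lemma boostK q : q != 0 -> boost q *m boost q^-1 = 1%:M.
Proof. by move=> q0; rewrite boostM ?invr_eq0 // divff // boost1. Qed.

Lemma boostVK q : q != 0 -> boost q^-1 *m boost q = 1%:M.
Proof. by move=> q0; rewrite boostM ?invr_eq0 // mulVf // boost1. Qed.

Lemma boost_axis q a : q != 0 -> boost q *m cv3 a a 0 = cv3 (q * a) (q * a) 0.
Proof. by move=> q0; rewrite mx3_cv3; congr cv3; field. Qed.

(* Neighbourhoods of the attracting points of the boosts. *)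
Definition cone_boost (v : 'cV[R]_3) : Prop := exists s a b c : R,
  [/\ s = 1 \/ s = -1, - (1 / 10) <= b, b <= 1 / 10, - (1 / 10) <= c & c <= 1 / 10] /\
  v = cv3 (a * (1 + b)) (s * (a * (1 - b))) (a * c).

(** A neighbourhood of the expanded axis of [rotdil 9 (1 / 3) T]. *)
Definition cone_pos (v : 'cV[R]_3) : Prop := exists x b c : R,
  [/\ - (1 / 2) <= b, b <= 1 / 2, - (1 / 2) <= c & c <= 1 / 2] /\
  v = cv3 x (x * b) (x * c).

(* [C] and [T] are the cosine and the sine of a multiple of [2 pi / 3]. *)
Definition order3 (C T : R) : Prop := C = 1 /\ T = 0 \/ C = - (1 / 2) /\ T ^+ 2 = 3 / 4.

(* Around the contracted plane of [rotdil 9 (1 / 3) T] only three directions are needed, since the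
   rotation has order 3; this is what the perturbations of the angle destroy. *)
Definition cone_neg (v : 'cV[R]_3) : Prop := exists y C T b c : R,
  [/\ order3 C T, - (1 / 10) <= b, b <= 1 / 10, - (1 / 8) <= c & c <= 1 / 8] /\
  v = cv3 (y * b) (y * (C - T * c)) (y * (T + C * c)).

Definition cone_rot (s : bool) (v : 'cV[R]_3) : Prop :=
  if s then cone_neg v else cone_pos v.

Lemma sqr34_bound (T : R) : T ^+ 2 = 3 / 4 -> - (7 / 8) <= T /\ T <= 7 / 8.
Proof. by move=> h; split; nra. Qed.

(** Near (1, 1, 0) and (1, -1, 0) the first coordinate is comparable to the norm; it is multiplied
    by 9 while the others shrink, and alone it accounts for the growth. *)
Lemma rotdil_cone_boost_pos T v : T ^+ 2 = 3 / 4 -> cone_boost v ->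
  cone_pos (rotdil 9 (1 / 3) T *m v) /\ 2 * sumsq v <= sumsq (rotdil 9 (1 / 3) T *m v).
Proof.
move=> TT [s [a [b [c [[hs b1 b2 c1 c2] ->]]]]]; rewrite mx3_cv3 !sumsq_cv3.
have [T1 T2] := sqr34_bound TT; split.
  have u0 : 0 < 9 * (1 + b) by lra.
  have [||eta [e1 e2 e3]] := @ratio_bound (1 / 2) (9 * (1 + b))
     (- (1 / 3 / 2) * (s * (1 - b)) - 1 / 3 * T * c) u0.
  - by case: hs => ->; nra.
  - by case: hs => ->; nra.
  have [||zeta [z1 z2 z3]] := @ratio_bound (1 / 2) (9 * (1 + b))
     (1 / 3 * T * (s * (1 - b)) - (1 / 3 / 2) * c) u0.
  - by case: hs => ->; nra.
  - by case: hs => ->; nra.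
  exists (9 * (a * (1 + b))), eta, zeta; split => //.
  congr cv3; first by ring.
  - have -> : 9 * (a * (1 + b)) * eta = a * (9 * (1 + b) * eta) by ring.
    rewrite -e3; ring.
  - have -> : 9 * (a * (1 + b)) * zeta = a * (9 * (1 + b) * zeta) by ring.
    rewrite -z3; ring.
have ss : s ^+ 2 = 1 by case: hs => ->; ring.
apply: (@le_trans _ _ (a ^+ 2 * (81 * (1 + b) ^+ 2))); last by apply: sqr_le_sum3; ring.
have -> : 2 * ((a * (1 + b)) ^+ 2 + (s * (a * (1 - b))) ^+ 2 + (a * c) ^+ 2)
   = a ^+ 2 * (2 * (2 + 2 * b ^+ 2 + c ^+ 2)) by rewrite !exprMn ss; ring.
by apply: ler_wpM2l; [exact: sqr_ge0|nra].
Qed.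

Lemma rotdil_cone_pos T v : T ^+ 2 = 3 / 4 -> cone_pos v ->
  cone_pos (rotdil 9 (1 / 3) T *m v) /\ 2 * sumsq v <= sumsq (rotdil 9 (1 / 3) T *m v).
Proof.
move=> TT [x [b [c [[b1 b2 c1 c2] ->]]]]; rewrite mx3_cv3 !sumsq_cv3.
have [T1 T2] := sqr34_bound TT; split.
  have u0 : 0 < 9 :> R by lra.
  have [||eta [e1 e2 e3]] := @ratio_bound (1 / 2) 9 (- (1 / 3 / 2) * b - 1 / 3 * T * c) u0.
  - by nra.
  - by nra.
  have [||zeta [z1 z2 z3]] := @ratio_bound (1 / 2) 9 (1 / 3 * T * b - (1 / 3 / 2) * c) u0.
  - by nra.
  - by nra.
  exists (9 * x), eta, zeta; split => //.
  congr cv3; first by ring.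
  - have -> : 9 * x * eta = x * (9 * eta) by ring.
    rewrite -e3; ring.
  - have -> : 9 * x * zeta = x * (9 * zeta) by ring.
    rewrite -z3; ring.
apply: (@le_trans _ _ (x ^+ 2 * 81)); last by apply: sqr_le_sum3; ring.
have -> : 2 * (x ^+ 2 + (x * b) ^+ 2 + (x * c) ^+ 2) = x ^+ 2 * (2 * (1 + b ^+ 2 + c ^+ 2)) by ring.
by apply: ler_wpM2l; [exact: sqr_ge0|nra].
Qed.

Lemma rotdil_inv T : T ^+ 2 = 3 / 4 -> rotdil 9 (1 / 3) T *m rotdil (1 / 9) 3 (- T) = 1%:M.
Proof.
move=> TT; have T2 : T * T = 3 / 4 by rewrite -expr2.
rewrite mx3_mul mx3_1; congr mx3; lra.
Qed.

(** Multiplication by a primitive cube root of unity permutes the cube roots of unity; equal squares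
    force [T = S] or [T = - S]. *)
Lemma order3_mul (C T S : R) : order3 C T -> S ^+ 2 = 3 / 4 ->
  order3 (- (1 / 2) * C - S * T) (S * C - (1 / 2) * T).
Proof.
move=> [[-> ->]|[-> TT]] SS; first by right; split; lra.
have : (T - S) * (T + S) = 0 by rewrite -subr_sqr TT SS subrr.
move/eqP; rewrite mulf_eq0 => /orP [/eqP e|/eqP e].
  have -> : T = S by lra.
  by right; split; lra.
have -> : T = - S by lra.
by left; split; lra.
Qed.

Lemma order3_rot_sqr (C T c : R) : order3 C T ->
  (C - T * c) ^+ 2 + (T + C * c) ^+ 2 = 1 + c ^+ 2.
Proof.
move=> h; have e : C ^+ 2 + T ^+ 2 = 1 by case: h => [[-> ->]|[-> ->]]; lra.
have -> : (C - T * c) ^+ 2 + (T + C * c) ^+ 2 = (C ^+ 2 + T ^+ 2) * (1 + c ^+ 2) by ring.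
by rewrite e mul1r.
Qed.

Lemma sumsq_order3 (y b C T c : R) : order3 C T ->
  sumsq (cv3 (y * b) (y * (C - T * c)) (y * (T + C * c))) = y ^+ 2 * (b ^+ 2 + (1 + c ^+ 2)).
Proof.
move=> CT; rewrite sumsq_cv3 -(order3_rot_sqr c CT); ring.
Qed.

(** The inverse matrix moves one of the three directions to another, keeps the angular deviation [c]
    and divides the relative height [b] by 27. *)
Lemma rotdil_cone_neg T v : T ^+ 2 = 3 / 4 -> cone_neg v ->
  cone_neg (rotdil (1 / 9) 3 (- T) *m v) /\ 2 * sumsq v <= sumsq (rotdil (1 / 9) 3 (- T) *m v).
Proof.
move=> TT [y [C [S [b [c [[CS b1 b2 c1 c2] ->]]]]]].
have CS' : order3 (- (1 / 2) * C - (- T) * S) (- T * C - (1 / 2) * S).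
  by apply: order3_mul => //; rewrite sqrrN.
have e : rotdil (1 / 9) 3 (- T) *m cv3 (y * b) (y * (C - S * c)) (y * (S + C * c)) =
    cv3 (3 * y * (b / 27)) (3 * y * ((- (1 / 2) * C - (- T) * S) - (- T * C - (1 / 2) * S) * c))
      (3 * y * ((- T * C - (1 / 2) * S) + (- (1 / 2) * C - (- T) * S) * c)).
  by rewrite mx3_cv3; congr cv3; field.
rewrite e; split.
  by exists (3 * y), (- (1 / 2) * C - (- T) * S), (- T * C - (1 / 2) * S), (b / 27), c;
    split => //; split => //; lra.
rewrite !sumsq_order3 //.
have -> : (3 * y) ^+ 2 * ((b / 27) ^+ 2 + (1 + c ^+ 2)) =
  y ^+ 2 * (9 * ((b / 27) ^+ 2 + (1 + c ^+ 2))) by ring.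
rewrite mulrCA; apply: ler_wpM2l; first exact: sqr_ge0.
by nra.
Qed.

(** The attracting points of boosts project to the second axis, which the rotation carries to one of
    the three directions; the sign [s] goes into the scale. *)
Lemma rotdil_cone_boost_neg T v : T ^+ 2 = 3 / 4 -> cone_boost v ->
  cone_neg (rotdil (1 / 9) 3 (- T) *m v) /\ 2 * sumsq v <= sumsq (rotdil (1 / 9) 3 (- T) *m v).
Proof.
move=> TT [s [a [b [c [[hs b1 b2 c1 c2] ->]]]]].
have TT' : (- T) ^+ 2 = 3 / 4 by rewrite sqrrN.
have CS : order3 (- (1 / 2)) (- T) by right.
have u0 : 0 < 3 * (1 - b) by lra.
have [||x [x1 x2 x3]] := @ratio_bound (1 / 10) (3 * (1 - b)) (1 / 9 * (s * (1 + b))) u0.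
- by case: hs => ->; lra.
- by case: hs => ->; lra.
(* The deviation becomes relative to [1 - b], at least 9/10, so 1/10 widens to 1/8 once; later steps
   preserve it. *)
have [|||z [z1 z2 z3]] := @ratio_bound (1 / 8) (1 - b) (s * c).
- by lra.
- by case: hs => ->; lra.
- by case: hs => ->; lra.
have ss : s * s = 1 by case: hs => ->; ring.
have zc : c = (1 - b) * z * s by rewrite -z3 mulrAC ss mul1r.
have e : rotdil (1 / 9) 3 (- T) *m cv3 (a * (1 + b)) (s * (a * (1 - b))) (a * c) =
    cv3 (3 * (s * (a * (1 - b))) * x) (3 * (s * (a * (1 - b))) * (- (1 / 2) - (- T) * z))
      (3 * (s * (a * (1 - b))) * ((- T) + (- (1 / 2)) * z)).
  rewrite mx3_cv3; congr cv3.
  - have -> : 3 * (s * (a * (1 - b))) * x = s * a * (3 * (1 - b) * x) by ring.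
    rewrite -x3 [RHS](_ : _ = s * s * (a * (1 / 9 * (1 + b)))); last by ring.
    by rewrite ss; field.
  - by rewrite zc; field.
  - by rewrite zc; field.
rewrite e; split.
  by exists (3 * (s * (a * (1 - b)))), (- (1 / 2)), (- T), x, z.
rewrite sumsq_order3 // sumsq_cv3.
rewrite [X in X <= _](_ : _ = a ^+ 2 * (2 * ((1 + b) ^+ 2 + s * s * (1 - b) ^+ 2 + c ^+ 2)));
  last by ring.
rewrite [X in _ <= X](_ : _ = a ^+ 2 * ((s * s) * (9 * (1 - b) ^+ 2 * (x ^+ 2 + (1 + z ^+ 2)))));
  last by ring.
apply: ler_wpM2l; first exact: sqr_ge0.
rewrite ss !mul1r.
have x0 := sqr_ge0 x; have z0 := sqr_ge0 z.
have b81 : 81 / 100 <= (1 - b) ^+ 2 by nra.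
have : 9 * (1 - b) ^+ 2 * 1 <= 9 * (1 - b) ^+ 2 * (x ^+ 2 + (1 + z ^+ 2)).
  by apply: ler_wpM2l; lra.
by nra.
Qed.

(* Vectors with both light-like coordinates [(x + y) / 2] and [(x - y) / 2] of the order of
   their norm. *)
Definition spread (w al be ga : R) : Prop :=
  [/\ 1 / 8 <= al \/ al <= - (1 / 8), 1 / 8 <= be \/ be <= - (1 / 8) &
     [/\ - 1 <= al, al <= 1, - 1 <= be & be <= 1] /\ - 1 <= ga /\ ga <= 1].

(** Order 3 matters here: the three directions have cosine 1 or -1/2, so they avoid the third axis,
    which every boost fixes pointwise. *)
Lemma cone_rot_spread s v : cone_rot s v -> exists w al be ga : R,
  spread w al be ga /\ v = cv3 (w * (al + be)) (w * (al - be)) (w * ga).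
Proof.
case: s => /=.
  move=> [y [C [T [b [c [[CT b1 b2 c1 c2] ->]]]]]].
  exists y, ((b + (C - T * c)) / 2), ((b - (C - T * c)) / 2), (T + C * c).
  split; last by congr cv3; field.
  case: CT => [[-> ->]|[-> TT]].
    by split; [left|right|do ![split]]; lra.
  have [T1 T2] := sqr34_bound TT.
  have p1 : T * c <= 7 / 64 by nra.
  have p2 : - (7 / 64) <= T * c by nra.
  by split; [right|left|do ![split]]; lra.
move=> [x [b [c [[b1 b2 c1 c2] ->]]]].
exists x, ((1 + b) / 2), ((1 - b) / 2), c; split; last by congr cv3; field.
by split; [left|left|do ![split]]; lra.
Qed.

(** In light-like coordinates the boost multiplies [al] by [q] and [be] by [q^-1]; as [q * al] is at
    least 25/2, it dominates the rest by a factor 10. *)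
Lemma boost_spread_pos q w al be ga : 100 <= q -> spread w al be ga -> 0 < al ->
  cone_boost (boost q *m cv3 (w * (al + be)) (w * (al - be)) (w * ga)).
Proof.
move=> q1 [h1 h2 [[a1 a2 b1 b2] [g1 g2]]] a0.
have q0 : 0 < q by lra.
have al8 : 1 / 8 <= al by case: h1 => //; lra.
have qa : 25 / 2 <= q * al by nra.
have u0 : 0 < q * al by lra.
have qi : q^-1 <= 1 / 100 by rewrite div1r lef_pV2 ?posrE.
have qi0 : 0 <= q^-1 by rewrite invr_ge0 ltW.
have [||x [x1 x2 x3]] := @ratio_bound (1 / 10) (q * al) (q^-1 * be) u0.
- by nra.
- by nra.
have [||z [z1 z2 z3]] := @ratio_bound (1 / 10) (q * al) ga u0.
- by lra.
- by lra.
exists 1, (w * (q * al)), x, z; split; first by split=> //; left.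
rewrite mx3_cv3; congr cv3.
- have -> : w * (q * al) * (1 + x) = w * (q * al + q * al * x) by ring.
  by rewrite -x3; field; rewrite lt0r_neq0.
- have -> : 1 * (w * (q * al) * (1 - x)) = w * (q * al - q * al * x) by ring.
  by rewrite -x3; field; rewrite lt0r_neq0.
- by rewrite z3; ring.
Qed.

Lemma spread_opp w al be ga : spread w al be ga -> spread (- w) (- al) (- be) (- ga).
Proof.
move=> [h1 h2 [[a1 a2 b1 b2] [g1 g2]]].
by split; [case: h1; [right|left]|case: h2; [right|left]|do ![split]]; lra.
Qed.

Lemma boost_spread_large q w al be ga : 100 <= q -> spread w al be ga ->
  cone_boost (boost q *m cv3 (w * (al + be)) (w * (al - be)) (w * ga)).
Proof.
move=> q1 sp; have [a0|a0] := ltP 0 al; first exact: boost_spread_pos.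
have -> : cv3 (w * (al + be)) (w * (al - be)) (w * ga) =
    cv3 (- w * (- al + - be)) (- w * (- al - - be)) (- w * - ga) by congr cv3; ring.
apply: boost_spread_pos => //; first exact: spread_opp.
by case: sp => h _ _; case: h; lra.
Qed.

Lemma cone_boost_flip x y z : cone_boost (cv3 x y z) -> cone_boost (cv3 x (- y) z).
Proof.
move=> [s [a [b [c [[hs b1 b2 c1 c2] e]]]]].
exists (- s), a, b, c; split.
  by split=> //; case: hs => ->; [right|left]; rewrite ?opprK.
have e0 := congr1 (fun v : 'cV[R]_3 => v o0 0) e.
have e1 := congr1 (fun v : 'cV[R]_3 => v o1 0) e.
have e2 := congr1 (fun v : 'cV[R]_3 => v o2 0) e.
by move: e0 e1 e2; rewrite !mxE /= => -> -> ->; congr cv3; ring.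
Qed.

(** Reflecting the second coordinate conjugates a boost to its inverse, which reduces small ratios
    to large ones. *)
Lemma boost_flip q x y z a b c : q != 0 -> boost q^-1 *m cv3 x (- y) z = cv3 a (- b) c ->
  boost q *m cv3 x y z = cv3 a b c.
Proof.
move=> q0 e.
have e0 := congr1 (fun v : 'cV[R]_3 => v o0 0) e.
have e1 := congr1 (fun v : 'cV[R]_3 => v o1 0) e.
have e2 := congr1 (fun v : 'cV[R]_3 => v o2 0) e.
move: e0 e1 e2; rewrite !mx3_cv3 !mxE /= !invrK => e0 e1 e2.
by congr cv3; lra.
Qed.

Definition far (q : R) : Prop := 100 <= q \/ 0 < q /\ q <= 1 / 100.

Lemma far_neq0 q : far q -> q != 0.
Proof. by move=> [h|[h _]]; rewrite lt0r_neq0 //; lra. Qed.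

Lemma boost_spread q w al be ga : far q -> spread w al be ga ->
  cone_boost (boost q *m cv3 (w * (al + be)) (w * (al - be)) (w * ga)).
Proof.
move=> fq sp; have qn0 := far_neq0 fq; case: fq => [q1|[q0 q1]]; first exact: boost_spread_large.
have qi : 100 <= q^-1.
  have -> : 100 = (1 / 100)^-1 :> R by rewrite div1r invrK.
  by rewrite lef_pV2 ?posrE //; lra.
have sp' : spread w be al ga by case: sp => h1 h2 [[a1 a2 b1 b2] h3].
have := boost_spread_large qi sp'; rewrite [boost _ *m _]cv3_eta.
set v := boost _ *m _ => cb.
rewrite (@boost_flip q _ _ _ (v o0 0) (- v o1 0) (v o2 0)) //; first exact: cone_boost_flip.
rewrite opprK -cv3_eta /v; congr (_ *m cv3 _ _ _); ring.
Qed.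

Lemma sumsq_boost_spread q w al be ga : far q -> spread w al be ga ->
  sumsq (cv3 (w * (al + be)) (w * (al - be)) (w * ga)) <=
  sumsq (boost q *m cv3 (w * (al + be)) (w * (al - be)) (w * ga)).
Proof.
move=> fq [h1 h2 [[a1 a2 b1 b2] [g1 g2]]]; have q0 := far_neq0 fq.
rewrite mx3_cv3 !sumsq_cv3.
rewrite [X in X <= _](_ : _ = w ^+ 2 * (2 * al ^+ 2 + 2 * be ^+ 2 + ga ^+ 2)); last by ring.
rewrite [X in _ <= X](_ : _ = w ^+ 2 * (2 * (q ^+ 2 * al ^+ 2) + 2 * (q^-1 ^+ 2 * be ^+ 2) + ga ^+ 2));
  last by field.
apply: ler_wpM2l; first exact: sqr_ge0.
have small (t : R) : - 1 <= t -> t <= 1 -> t ^+ 2 <= 1 by clear; move=> *; nra.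
have big (t : R) : 1 / 8 <= t \/ t <= - (1 / 8) -> 1 / 64 <= t ^+ 2.
  by clear; move=> [h|h]; nra.
have sa := small _ a1 a2; have sb := small _ b1 b2; have ba := big _ h1; have bb := big _ h2.
have pos (s t : R) : 0 <= s ^+ 2 * t ^+ 2 by apply: mulr_ge0; exact: sqr_ge0.
have p1 := pos q al; have p2 := pos q^-1 be.
(* 10000/64 far exceeds 2, an upper bound for [al ^+ 2 + be ^+ 2]. *)
have key (s t : R) : 100 <= s -> 1 / 64 <= t ^+ 2 -> 2 <= s ^+ 2 * t ^+ 2.
  clear => s1 t1; have s2 : 10000 <= s ^+ 2 by nra.
  have : 10000 * (1 / 64) <= s ^+ 2 * t ^+ 2 by apply: ler_pM => //; lra.
  by lra.
case: fq => [q1|[q1 q2]]; first by have := key _ _ q1 ba; clear -sa sb p2; lra.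
have qi : 100 <= q^-1.
  have -> : 100 = (1 / 100)^-1 :> R by rewrite div1r invrK.
  by rewrite lef_pV2 ?posrE //; lra.
by have := key _ _ qi bb; clear -sa sb p1; lra.
Qed.

Lemma boost_cone_rot q s v : far q -> cone_rot s v ->
  cone_boost (boost q *m v) /\ sumsq v <= sumsq (boost q *m v).
Proof.
move=> fq /cone_rot_spread [w [al [be [ga [sp ->]]]]].
by split; [exact: boost_spread|exact: sumsq_boost_spread].
Qed.

Definition rot_letter (T : R) (s : bool) : 'M[R]_3 :=
  if s then rotdil (1 / 9) 3 (- T) else rotdil 9 (1 / 3) T.

Lemma rot_letter_cone T s v : T ^+ 2 = 3 / 4 -> cone_boost v \/ cone_rot s v ->
  cone_rot s (rot_letter T s *m v) /\ 2 * sumsq v <= sumsq (rot_letter T s *m v).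
Proof.
move=> TT; case: s => /= - [h|h].
- exact: rotdil_cone_boost_neg.
- exact: rotdil_cone_neg.
- exact: rotdil_cone_boost_pos.
- exact: rotdil_cone_pos.
Qed.

(* Every generator is a loxodromic matrix with a rotation by an angle [+- 2 pi / 3] in its
   contracted plane, conjugated by a boost; distinct generators use far apart boosts. *)
Section PingPong.
Variables (k : nat) (lam Tw : 'I_k -> R).
Hypotheses (lam_gt0 : forall i, 0 < lam i) (Tw2 : forall i, Tw i ^+ 2 = 3 / 4).
Hypothesis lam_far : forall i j, i != j -> far (lam j / lam i).

Definition schottky (i : 'I_k) : 'M[R]_3 :=
  boost (lam i) *m rotdil 9 (1 / 3) (Tw i) *m boost (lam i)^-1.

Lemma lam_neq0 i : lam i != 0. Proof. exact: lt0r_neq0. Qed.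

Lemma invmx_schottky i : invmx (schottky i) =
  boost (lam i) *m rotdil (1 / 9) 3 (- Tw i) *m boost (lam i)^-1.
Proof.
apply: invmx_eq; rewrite /schottky -!mulmxA (mulmxA (boost (lam i)^-1)).
rewrite boostVK ?lam_neq0 // mul1mx.
by rewrite (mulmxA (rotdil _ _ _)) rotdil_inv // mul1mx boostK ?lam_neq0.
Qed.

Lemma letter_schottky x : letter_mx schottky x =
  boost (lam x.1) *m rot_letter (Tw x.1) x.2 *m boost (lam x.1)^-1.
Proof. by rewrite /letter_mx /rot_letter; case: x.2 => //; rewrite invmx_schottky. Qed.

(** Here [u] is the current vector in the frame of the next letter [x]. After a letter of another
    generator the change of frame is a [far] boost, landing in [cone_boost]; after the same
    generator [u] is still in the cone of that letter. [rot_letter_cone] accepts both and doubles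
    the squared norm. *)
Lemma schottky_cone (K : R) : (forall i, K <= 2 * (lam i)^-1 ^+ 2) ->
  forall t x, reduced (x :: t) ->
  let u := boost (lam x.1)^-1 *m (word_mx schottky t *m cv3 1 1 0) in
  (cone_boost u \/ cone_rot x.2 u) /\ K * 2 ^+ size t <= sumsq u.
Proof.
move=> KB; elim=> [|y t IHt] x rxt u.
  (* The start vector is an eigenvector of every boost, so it is in [cone_boost] in every frame; [K]
     absorbs its varying length. *)
  rewrite /u word_mx_nil mul1mx boost_axis ?invr_eq0 ?lam_neq0 // mulr1.
  split; last by rewrite sumsq_cv3 expr0 mulr1 expr0n /= addr0 -mulr2n -mulr_natl KB.
  left; exists 1, (lam x.1)^-1, 0, 0; split; last by congr cv3; ring.
  by split; [left|lra..].
have ryt : reduced (y :: t) by case/andP: rxt.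
have [cone growth] := IHt y ryt.
set u0 := boost _ *m _ in cone growth.
have [cr gr] := rot_letter_cone (Tw2 y.1) cone.
set u1 := rot_letter _ _ *m _ in cr gr.
have uE : u = boost (lam y.1 / lam x.1) *m u1.
  rewrite /u word_mx_cons letter_schottky /u1 /u0 !mulmxA boostM ?invr_eq0 ?lam_neq0 //.
  by rewrite (mulrC (lam x.1)^-1).
have g1 : K * 2 ^+ size (y :: t) <= sumsq u1.
  by apply: le_trans gr; rewrite /= exprS mulrCA; apply: ler_wpM2l.
have [e|ne] := eqVneq x.1 y.1.
  (* In a reduced word, neighbouring letters of one generator have the same sign. *)
  have s12 : x.2 = y.2 by case/andP: rxt; rewrite e eqxx /= negbK => /eqP.
  rewrite uE e divff ?lam_neq0 // boost1 mul1mx s12.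
  by split; first by right.
have [cb gb] := boost_cone_rot (lam_far ne) cr.
by rewrite uE; split; [left|exact: le_trans gb].
Qed.

Lemma cone_rot_boost_growth : forall i, lam i = 1 \/ far (lam i) ->
  forall s v, cone_rot s v -> sumsq v <= sumsq (boost (lam i) *m v).
Proof.
move=> i [->|fl] s v cv; first by rewrite boost1 mul1mx.
by have [] := boost_cone_rot fl cv.
Qed.

(** [schottky_cone] stops in the frame of the first letter: that letter gives the last doubling, and
    returning to the standard frame does not shorten the vector. *)
Lemma schottky_growth (K : R) : 0 <= K -> (forall i, lam i = 1 \/ far (lam i)) ->
  (forall i, K <= 2 * (lam i)^-1 ^+ 2) -> K <= 2 ->
  forall w, reduced w -> K * 2 ^+ size w <= sumsq (word_mx schottky w *m cv3 1 1 0).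
Proof.
move=> K0 fl KB K2 [|x t] rw.
  rewrite word_mx_nil mul1mx sumsq_cv3; lra.
have [cone growth] := schottky_cone KB rw.
set u := boost _ *m _ in cone growth.
have [cr gr] := rot_letter_cone (Tw2 x.1) cone.
rewrite word_mx_cons letter_schottky -!mulmxA.
apply: le_trans (cone_rot_boost_growth (fl x.1) cr); apply: le_trans gr.
by rewrite /= exprS mulrCA; apply: ler_wpM2l.
Qed.

Lemma schottky_quasi_isometric (K : R) : 0 < K -> (forall i, lam i = 1 \/ far (lam i)) ->
  (forall i, K <= 2 * (lam i)^-1 ^+ 2) -> K <= 2 -> quasi_isometric schottky.
Proof.
move=> K0 fl KB K2; apply: (@quasi_isometric_frob2 _ _ (K / 2) 2); [lra|lra|move=> g].
have := schottky_growth (ltW K0) fl KB K2 (svalP g).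
have := sumsq_mul (word_mx schottky (sval g)) (cv3 1 1 0).
rewrite [X in _ <= _ * X]sumsq_cv3 -/(wlen g) -[word_mx _ _]/(evalrep schottky g).
move: (frob2 _) (sumsq _) (2 ^+ _) => F S P h1 h2.
lra.
Qed.
End PingPong.

(** * Perturbations *)

Arguments cos x%_ring_scope.
Arguments sin x%_ring_scope.

Definition tends (u : nat -> R) (l : R) : Prop :=
  forall e, 0 < e -> exists n0 : nat, forall n, (n0 <= n)%N -> `|u n - l| < e.

Lemma tendsE u l : tends u l <-> Un_cv u l.
Proof.
split=> h e.
  move=> /RltP e0; have [n0 hn] := h e e0; exists n0 => n /ssrnat.leP nn.
  by apply/RltP; rewrite RdistE; exact: hn.
move=> e0; have [|n0 hn] := h e; first exact/RltP.
by exists n0 => n /ssrnat.leP nn; have /RltP := hn n nn; rewrite RdistE.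
Qed.

Lemma tends_cst l : tends (fun=> l) l.
Proof. by move=> e e0; exists 0%N => n _; rewrite subrr normr0. Qed.

Lemma tends_ext u v l : (forall n, u n = v n) -> tends u l -> tends v l.
Proof. by move=> uv h e e0; have [n0 hn] := h e e0; exists n0 => n; rewrite -uv; exact: hn. Qed.

Lemma tendsD u v a b : tends u a -> tends v b -> tends (fun n => u n + v n) (a + b).
Proof. by move=> /tendsE hu /tendsE hv; apply/tendsE; exact: CV_plus. Qed.

Lemma tendsM u v a b : tends u a -> tends v b -> tends (fun n => u n * v n) (a * b).
Proof. by move=> /tendsE hu /tendsE hv; apply/tendsE; exact: CV_mult. Qed.

Lemma tendsB u v a b : tends u a -> tends v b -> tends (fun n => u n - v n) (a - b).
Proof.
move=> hu hv; have h := tendsD hu (tendsM (tends_cst (-1)) hv).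
by rewrite mulN1r in h; apply: tends_ext h => n; rewrite mulN1r.
Qed.

Lemma tends_cos u l : tends u l -> tends (fun n => cos (u n)) (cos l).
Proof. by move=> /tendsE hu; apply/tendsE; exact: (@Rsqrt_def.continuity_seq cos u l (continuity_cos l) hu). Qed.

Lemma tends_sin u l : tends u l -> tends (fun n => sin (u n)) (sin l).
Proof. by move=> /tendsE hu; apply/tendsE; exact: (@Rsqrt_def.continuity_seq sin u l (continuity_sin l) hu). Qed.

Lemma tends_inv_nat C u : (forall n, `|u n| <= C / n.+1%:R) -> tends u 0.
Proof.
move=> hu e e0; exists (Num.bound (`|C| / e)) => n nn; rewrite subr0.
have C0 : 0 <= `|C| / e by rewrite divr_ge0 // ltW.
have h : `|C| / e < n.+1%:R.
  by apply: lt_le_trans (archi_boundP C0) _; rewrite ler_nat leqW.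
apply: le_lt_trans (hu n) _; rewrite ltr_pdivrMr // mulrC.
by move: h; rewrite ltr_pdivrMr // => /(le_lt_trans (ler_norm _)).
Qed.

Definition tends_mx (A : nat -> 'M[R]_3) (B : 'M[R]_3) : Prop :=
  forall i j, tends (fun n => A n i j) (B i j).

Lemma tends_mx_cst B : tends_mx (fun=> B) B.
Proof. by move=> i j; exact: tends_cst. Qed.

Lemma tends_mxM A A' B B' : tends_mx A B -> tends_mx A' B' ->
  tends_mx (fun n => A n *m A' n) (B *m B').
Proof.
move=> hA hA' i j; rewrite mxE sum_ord3.
apply: (@tends_ext (fun n => A n i o0 * A' n o0 j + A n i o1 * A' n o1 j + A n i o2 * A' n o2 j)).
  by move=> n; rewrite mxE sum_ord3.
by apply: tendsD; [apply: tendsD|]; apply: tendsM.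
Qed.

Lemma tends_mx3 (a b c d e f g h i : nat -> R) a' b' c' d' e' f' g' h' i' :
  tends a a' -> tends b b' -> tends c c' -> tends d d' -> tends e e' -> tends f f' ->
  tends g g' -> tends h h' -> tends i i' ->
  tends_mx (fun n => mx3 (a n) (b n) (c n) (d n) (e n) (f n) (g n) (h n) (i n))
    (mx3 a' b' c' d' e' f' g' h' i').
Proof.
move=> *; do 2![apply: ord3_ind]; rewrite mxE /=;
  by match goal with H : tends ?u _ |- tends _ ?l => apply: (tends_ext _ H) => n; rewrite mxE end.
Qed.

Lemma tends_adj3 A B : tends_mx A B -> tends_mx (fun n => adj3 (A n)) (adj3 B).
Proof. by move=> h; apply: tends_mx3; apply: tendsB; apply: tendsM; exact: h. Qed.

Section NonRobust.
Variable k : nat.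

(** Word evaluation is polynomial in the generators, inverses being [adj3] on SL_3. *)
Lemma tends_word (rho : nat -> 'I_k -> 'M[R]_3) rho0 w :
  (forall n, SL3rep (rho n)) -> SL3rep rho0 -> (forall i, tends_mx (rho^~ i) (rho0 i)) ->
  tends_mx (fun n => word_mx (rho n) w) (word_mx rho0 w).
Proof.
move=> sl sl0 h; elim: w => [|x w IHw] i j.
  by apply: (@tends_ext (fun=> (1%:M : 'M[R]_3) i j)) => [n|]; rewrite word_mx_nil //; exact: tends_cst.
rewrite word_mx_cons; apply: (@tends_ext (fun n => (letter_mx (rho n) x *m word_mx (rho n) w) i j)).
  by move=> n; rewrite word_mx_cons.
apply: tends_mxM => // {i j}; case: x => i [] i1 j1; rewrite /letter_mx /=; last exact: h.
rewrite invmx_adj3; last exact: sl0.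
apply: (@tends_ext (fun n => (adj3 (rho n i)) i1 j1)).
  by move=> n; rewrite /= invmx_adj3 //; exact: sl.
exact: tends_adj3.
Qed.

Lemma not_robust_sequence (P : ('I_k -> 'M[R]_3) -> Prop) rho rho0 :
  (forall n, SL3rep (rho n)) -> SL3rep rho0 -> (forall i, tends_mx (rho^~ i) (rho0 i)) ->
  (forall n : nat, ~ P (rho n)) -> ~ robust P rho0.
Proof.
move=> sl sl0 lim nP [F [eps [eps0 rob]]].
suff [n0 hn] : exists n0 : nat, forall n, (n0 <= n)%N -> basic_nbhd rho0 F eps (rho n).
  by apply: (nP n0); apply: rob => //; exact: hn.
have evg (g : FG k) : exists n0 : nat, forall n, (n0 <= n)%N -> forall i j : 'I_3,
    `|evalrep (rho n) g i j - evalrep rho0 g i j| < eps.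
  have hij i j := tends_word (sval g) sl sl0 lim i j eps0.
  have row i : exists n0 : nat, forall n, (n0 <= n)%N -> forall j : 'I_3,
      `|evalrep (rho n) g i j - evalrep rho0 g i j| < eps.
    have [n0 h0] := hij i o0; have [n1 h1] := hij i o1; have [n2 h2] := hij i o2.
    exists (maxn n0 (maxn n1 n2)) => n; rewrite !geq_max => /and3P [m0 m1 m2].
    by apply: ord3_ind; [exact: h0|exact: h1|exact: h2].
  have [n0 h0] := row o0; have [n1 h1] := row o1; have [n2 h2] := row o2.
  exists (maxn n0 (maxn n1 n2)) => n; rewrite !geq_max => /and3P [m0 m1 m2].
  by apply: ord3_ind => j; [exact: h0|exact: h1|exact: h2].
elim: F {rob} => [|g F [n0 h0]]; first by exists 0%N => n _ g.
have [n1 h1] := evg g; exists (maxn n0 n1) => n; rewrite geq_max => /andP [m0 m1] g'.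
by rewrite inE => /predU1P [->|/(h0 n m0)] //; exact: h1.
Qed.
End NonRobust.

(* Conjugating by [C^-n], [C^n] leaves a matrix bounded as soon as it fixes the line expanded
   by [C]; so such a relation between two elements is an obstruction. *)
Lemma not_quasi_isometric_common_line (k : nat) (rho : 'I_k -> 'M[R]_3) i m (P r : R)
    (w : seq (letter k)) : SL3rep rho -> (0 < m)%N -> P != 0 -> r != 0 -> (r / P) ^+ 2 <= 1 ->
  rho i ^+ m = mx3 P 0 0 0 r 0 0 0 r ->
  word_mx rho w o1 o0 = 0 -> word_mx rho w o2 o0 = 0 ->
  (forall n : nat, reduced (nseq n (i, true) ++ w ++ nseq n (i, false))) ->
  ~ quasi_isometric rho.
Proof.
move=> sl m0 P0 r0 rP cm f1 f2 red.
apply: (@not_quasi_isometric_frob2 _ _ (fun j => word (red (m * j)%N)) (frob2 (word_mx rho w)) sl).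
  move=> j; rewrite /wlen /= !size_cat !size_nseq; apply: leq_trans (leq_addr _ _).
  by rewrite leq_pmull.
move=> j; have -> : evalrep rho (word (red (m * j)%N)) =
    invmx (rho i) ^+ (m * j) *m (word_mx rho w *m rho i ^+ (m * j)).
  by rewrite -[LHS]/(word_mx rho _) !word_mx_cat !word_mx_nseq.
have uC : rho i \in unitmx by exact: unitmx_rep.
have D : rho i ^+ (m * j) = mx3 (P ^+ j) 0 0 0 (r ^+ j) 0 0 0 (r ^+ j).
  rewrite exprM cm; elim: j => [|j IHj]; first by rewrite !expr0; exact: mx3_1.
  by rewrite exprS IHj -mulmxE mx3_mul; congr mx3; rewrite ?exprS; ring.
have Dinv : rho i ^+ (m * j) *m mx3 (P ^+ j)^-1 0 0 0 (r ^+ j)^-1 0 0 0 (r ^+ j)^-1 = 1%:M.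
  by rewrite D mx3_mul mx3_1; congr mx3; rewrite ?mulfV ?expf_neq0 //; ring.
have -> : invmx (rho i) ^+ (m * j) = mx3 (P ^+ j)^-1 0 0 0 (r ^+ j)^-1 0 0 0 (r ^+ j)^-1.
  rewrite -[LHS]mulmx1 -Dinv mulmxA.
  have -> : invmx (rho i) ^+ (m * j) *m rho i ^+ (m * j) = 1%:M.
    rewrite mulmxE -exprMn_comm; last by rewrite /GRing.comm -!mulmxE mulVmx // mulmxV.
    by rewrite -mulmxE mulVmx // expr1n.
  by rewrite mul1mx.
rewrite D.
move: f1 f2; have [a [b [c [d [e [f [g [h [l ->]]]]]]]]] := mx3P (word_mx rho w).
rewrite !mxE /= => -> ->; rewrite !mx3_mul !frob2_mx3.
have u1 : (P ^+ j)^-1 * P ^+ j = 1 by rewrite mulVf ?expf_neq0.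
have u2 : (r ^+ j)^-1 * r ^+ j = 1 by rewrite mulVf ?expf_neq0.
have s1 : ((P ^+ j)^-1 * r ^+ j) ^+ 2 <= 1.
  by rewrite mulrC -expr_div_n exprAC; apply: exprn_ile1 => //; exact: sqr_ge0.
move: (P ^+ j) (P ^+ j)^-1 (r ^+ j) (r ^+ j)^-1 u1 u2 s1 => p p' q q' u1 u2 s1.
(* The conjugation keeps the lower block, preserves the zeros below the corner, and multiplies the
   rest of the first row by [(r / P) ^+ j]. *)
have -> : forall t0 t1 t2 t3 t4 t5 t6 t7 t8 : R, t0 = a -> t1 = p' * q * b -> t2 = p' * q * c ->
   t3 = 0 -> t4 = e -> t5 = f -> t6 = 0 -> t7 = h -> t8 = l ->
   t0 ^+ 2 + t1 ^+ 2 + t2 ^+ 2 + t3 ^+ 2 + t4 ^+ 2 + t5 ^+ 2 + t6 ^+ 2 + t7 ^+ 2 + t8 ^+ 2 =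
   a ^+ 2 + (p' * q) ^+ 2 * b ^+ 2 + (p' * q) ^+ 2 * c ^+ 2 + e ^+ 2 + f ^+ 2 + h ^+ 2 + l ^+ 2.
- by move=> t0 t1 t2 t3 t4 t5 t6 t7 t8 -> -> -> -> -> -> -> -> ->; ring.
- have h1 : (p' * q) ^+ 2 * b ^+ 2 <= 1 * b ^+ 2 by apply: ler_wpM2r => //; exact: sqr_ge0.
  have h2 : (p' * q) ^+ 2 * c ^+ 2 <= 1 * c ^+ 2 by apply: ler_wpM2r => //; exact: sqr_ge0.
  by rewrite !expr0n /=; lra.
- by rewrite [RHS](_ : _ = p' * p * a) ?u1 ?mul1r //; rewrite -[RHS]mul1r -u1; ring.
- by ring.
- by ring.
- by ring.
- by rewrite -[RHS]mul1r -u2; ring.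
- by rewrite -[RHS]mul1r -u2; ring.
- by ring.
- by rewrite -[RHS]mul1r -u2; ring.
- by rewrite -[RHS]mul1r -u2; ring.
Qed.

(** * Perturbing the angle *)

Definition loxo (p q th : R) : 'M[R]_3 :=
  mx3 p 0 0 0 (q * cos th) (- (q * sin th)) 0 (q * sin th) (q * cos th).

Lemma loxoM p q th p' q' th' : loxo p q th *m loxo p' q' th' = loxo (p * p') (q * q') (th + th').
Proof. by rewrite /loxo cosD sinD mx3_mul; congr mx3; ring. Qed.

Lemma cos_0R : cos 0 = 1. Proof. exact: cos_0. Qed.
Lemma sin_0R : sin 0 = 0. Proof. exact: sin_0. Qed.

Lemma loxo1 : loxo 1 1 0 = 1%:M.
Proof. by rewrite /loxo cos_0R sin_0R mx3_1; congr mx3; ring. Qed.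

Lemma loxoX p q th n : loxo p q th ^+ n = loxo (p ^+ n) (q ^+ n) (n%:R * th).
Proof.
elim: n => [|n IHn]; first by rewrite !expr0 mul0r loxo1.
by rewrite !exprS IHn -mulmxE loxoM -[in RHS]add1n natrD mulrDl mul1r.
Qed.

Lemma cos2_sin2 th : cos th ^+ 2 + sin th ^+ 2 = 1.
Proof.
rewrite -cos_0R -(subrr th) cosD.
by have := cos_neg th; have := sin_neg th; rewrite !RoppE => -> ->; ring.
Qed.

Lemma det_loxo p q th : \det (loxo p q th) = p * q ^+ 2.
Proof. rewrite /loxo mx3_det -[RHS]mulr1 -(cos2_sin2 th); ring. Qed.

Lemma cos_periodR x n : cos (x + 2 * n%:R * PI) = cos x.
Proof. by have := cos_period x n; rewrite INRE. Qed.

Lemma sin_periodR x n : sin (x + 2 * n%:R * PI) = sin x.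
Proof. by have := sin_period x n; rewrite INRE. Qed.

Lemma cos_two_thirds_pi : cos (2 * (PI / 3)) = - (1 / 2).
Proof. by have -> : cos (2 * (PI / 3)) = - 1 / 2 := cos_2PI3; lra. Qed.

Lemma sin_two_thirds_pi : sin (2 * (PI / 3)) ^+ 2 = 3 / 4.
Proof. by have := cos2_sin2 (2 * (PI / 3)); rewrite cos_two_thirds_pi; lra. Qed.

Lemma loxo_two_thirds_pi p q : loxo p q (2 * (PI / 3)) = rotdil p q (sin (2 * (PI / 3))).
Proof. by rewrite /loxo /rotdil cos_two_thirds_pi; congr mx3; ring. Qed.

Section Perturbation.
Variables (k : nat) (i0 i1 i2 : 'I_k) (rho : 'I_k -> 'M[R]_3).
Hypotheses (i01 : i0 != i1) (i12 : i1 != i2) (i02 : i0 != i2).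
Hypothesis slrho : SL3rep rho.
Hypothesis rho1 : rho i1 = loxo 9 (1 / 3) (2 * (PI / 3)).
Hypothesis rho0 : rho i0 = (rho i2)^T.
Hypothesis rho2_neq0 : rho i2 o1 o0 ^+ 2 + rho i2 o2 o0 ^+ 2 != 0.

Definition pangle (n : nat) : R := 2 * (PI / 3) + PI / 6 / n.+1%:R.

(** Let (a, d, g) be the first column of [rho i2], N = 3(n+1) and p the shear. After the right
    angle, the first coordinate of the image of the axis is a^2 9^(-N) - 3^N p a (d^2 + g^2),
    because the two terms in d g cancel; this value of p makes it vanish. *)
Definition pshear (n : nat) : R :=
  27%:R ^- (3 * n.+1) * (rho i2 o0 o0 / (rho i2 o1 o0 ^+ 2 + rho i2 o2 o0 ^+ 2)).

(* The angle of [rho i1] is chosen so that the [3 * n.+1]-th power rotates by a right angle; the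
   shear of [rho i2] is the correction that sends the axis of [rho i1] exactly into its contracted
   plane under [z C^(- 3 n.+1) y], where [z], [C], [y] are the generators [i0], [i1], [i2]. *)
Definition perturbed (n : nat) (i : 'I_k) : 'M[R]_3 :=
  if i == i1 then loxo 9 (1 / 3) (pangle n)
  else if i == i2 then
    mx3 1 0 0 (pshear n * rho i2 o2 o0) 1 0 (- (pshear n * rho i2 o1 o0)) 0 1 *m rho i2
  else rho i.

Lemma perturbed_SL3 n : SL3rep (perturbed n).
Proof.
move=> i; rewrite /perturbed; case: eqP => _; first by rewrite det_loxo; lra.
case: eqP => [_|_]; last exact: slrho.
by rewrite det_mulmx slrho mx3_det; ring.
Qed.

Lemma tends_pshear : tends pshear 0.
Proof.
set K := rho i2 o0 o0 / (rho i2 o1 o0 ^+ 2 + rho i2 o2 o0 ^+ 2).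
apply: (@tends_inv_nat `|K|) => n; rewrite /pshear normrM mulrC -/K.
apply: ler_wpM2l; first exact: normr_ge0.
have e0 : 0 < 27%:R ^+ (3 * n.+1) :> R by rewrite exprn_gt0 // ltr0n.
rewrite ger0_norm ?invr_ge0 ?(ltW e0) // lef_pV2 ?posrE ?ltr0n //.
rewrite -natrX ler_nat; apply: leq_trans (ltnW (ltn_expl n.+1 (isT : 1 < 27)%N)) _.
by rewrite leq_exp2l // leq_pmull.
Qed.

Lemma tends_pangle : tends pangle (2 * (PI / 3)).
Proof.
rewrite -[X in tends _ X]addr0; apply: tendsD; first exact: tends_cst.
by apply: (@tends_inv_nat `|PI / 6|) => n; rewrite normrM normfV normr_nat.
Qed.

Lemma tends_perturbed i : tends_mx (perturbed^~ i) (rho i).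
Proof.
rewrite /perturbed; have [->|_] := eqVneq i i1.
  rewrite rho1; apply: tends_mx3; try exact: tends_cst.
  - by apply: tendsM; [exact: tends_cst|exact: tends_cos tends_pangle].
  - apply: (@tends_ext (fun n => 0 - 1 / 3 * sin (pangle n))) => [n|]; first by rewrite sub0r.
    rewrite -[- _]sub0r; apply: tendsB; first exact: tends_cst.
    by apply: tendsM; [exact: tends_cst|exact: tends_sin tends_pangle].
  - by apply: tendsM; [exact: tends_cst|exact: tends_sin tends_pangle].
  - by apply: tendsM; [exact: tends_cst|exact: tends_cos tends_pangle].
have [->|_] := eqVneq i i2; last exact: tends_mx_cst.
rewrite -[X in tends_mx _ X]mul1mx; apply: tends_mxM; last exact: tends_mx_cst.
rewrite mx3_1; apply: tends_mx3; try exact: tends_cst.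
- apply: (@tends_ext (fun n => rho i2 o2 o0 * pshear n)) => [n|]; first by ring.
  by rewrite -(mulr0 (rho i2 o2 o0)); apply: tendsM; [exact: tends_cst|exact: tends_pshear].
- apply: (@tends_ext (fun n => - rho i2 o1 o0 * pshear n)) => [n|]; first by ring.
  by rewrite -(mulr0 (- rho i2 o1 o0)); apply: tendsM; [exact: tends_cst|exact: tends_pshear].
Qed.

Lemma perturbed_quarter_turn n :
  perturbed n i1 ^+ (3 * n.+1) = mx3 (9 ^+ (3 * n.+1)) 0 0
    0 0 (- (1 / 3) ^+ (3 * n.+1)) 0 ((1 / 3) ^+ (3 * n.+1)) 0.
Proof.
rewrite /perturbed eqxx loxoX /loxo.
have -> : (3 * n.+1)%:R * pangle n = PI / 2 + 2 * n.+1%:R * PI.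
  have n0 : n.+1%:R != 0 :> R by rewrite pnatr_eq0.
  by rewrite /pangle natrM; move: (n.+1%:R) n0 => t t0; field.
rewrite cos_periodR sin_periodR.
have -> : cos (PI / 2) = 0 := cos_PI2.
have -> : sin (PI / 2) = 1 := sin_PI2.
by congr mx3; ring.
Qed.

Lemma perturbed_period n : perturbed n i1 ^+ (4 * (3 * n.+1)) =
  mx3 (9 ^+ (4 * (3 * n.+1))) 0 0 0 ((1 / 3) ^+ (4 * (3 * n.+1))) 0
      0 0 ((1 / 3) ^+ (4 * (3 * n.+1))).
Proof.
move: (perturbed_quarter_turn n); move: (3 * n.+1)%N => m e.
rewrite mulnC exprM e !(exprM _ m).
move: (9 ^+ _) ((1 / 3) ^+ _) => p q.
by rewrite !exprS expr0 mulr1 -!mulmxE !mx3_mul; congr mx3; ring.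
Qed.

(** The word of g^(-1) C^q g with g = z C^(-p) y. *)
Definition common_line_word (p q : nat) : seq (letter k) :=
  (i2, true) :: nseq p (i1, false) ++ (i0, true) :: nseq q (i1, false)
    ++ (i0, false) :: nseq p (i1, true) ++ [:: (i2, false)].

Lemma word_mx_common_line (s : 'I_k -> 'M[R]_3) p q : word_mx s (common_line_word p q) =
  invmx (s i2) *m (s i1 ^+ p *m (invmx (s i0) *m (s i1 ^+ q *m
    (s i0 *m (invmx (s i1) ^+ p *m s i2))))).
Proof.
rewrite /common_line_word word_mx_cons word_mx_cat word_mx_nseq word_mx_cons word_mx_cat.
by rewrite word_mx_nseq word_mx_cons word_mx_cat word_mx_nseq word_mx_cons word_mx_nil mulmx1.
Qed.

Lemma common_line_word_reduced (p q j : nat) : (0 < p)%N -> (0 < q)%N ->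
  reduced (nseq j (i1, true) ++ common_line_word p q ++ nseq j (i1, false)).
Proof.
move=> p0 q0; rewrite /common_line_word.
have i10 : i1 != i0 by rewrite eq_sym.
have i21 : i2 != i1 by rewrite eq_sym.
have hd m (x y : letter k) w : (0 < m)%N -> x.1 != y.1 ->
    if nseq m y ++ w is z :: _ then ~~ ((x.1 == z.1) && (x.2 != z.2)) else true.
  by case: m => //= m _ /negPf ->.
rewrite cat_cons -!catA cat_cons -!catA cat_cons -!catA.
apply: reduced_nseq_cat; last by rewrite /= (negPf i12).
apply: reduced_cons; last exact: hd.
apply: reduced_nseq_cat; last by rewrite /= (negPf i10).
apply: reduced_cons; last exact: hd.
apply: reduced_nseq_cat; last by rewrite /= (negPf i10).
apply: reduced_cons; last exact: hd.
apply: reduced_nseq_cat; last by rewrite /= (negPf i12).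
apply: reduced_cons; first exact: reduced_nseq.
by case: j => //= j; rewrite (negPf i21).
Qed.

(** g moves the axis into the contracted plane, where C^(4N) is the scalar [r]; so the conjugate by
    g preserves the axis and [not_quasi_isometric_common_line] applies. *)
Lemma perturbed_not_quasi_isometric n : ~ quasi_isometric (perturbed n).
Proof.
pose N := (3 * n.+1)%N; have sl := perturbed_SL3 n.
pose C := perturbed n i1; pose y := perturbed n i2; pose z := perturbed n i0.
pose Ci := invmx C ^+ N.
have uC : C \in unitmx by exact: unitmx_rep.
have uy : y \in unitmx by exact: unitmx_rep.
have uz : z \in unitmx by exact: unitmx_rep.
have p9 : 9 ^+ N != 0 :> R by rewrite expf_neq0 // pnatr_eq0.
have p3 : (1 / 3) ^+ N != 0 :> R by rewrite expf_neq0 // lt0r_neq0 //; lra.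
have CCi : C ^+ N *m Ci = 1%:M.
  rewrite /Ci mulmxE -exprMn_comm; last by rewrite /GRing.comm -!mulmxE mulVmx // mulmxV.
  by rewrite -mulmxE mulmxV // expr1n.
have CiE : Ci = mx3 (9 ^+ N)^-1 0 0 0 0 ((1 / 3) ^+ N)^-1 0 (- ((1 / 3) ^+ N)^-1) 0.
  have [] := mulmx1_unit CCi => uCN _; rewrite -[LHS](mulKmx uCN) CCi mulmx1.
  apply: invmx_eq; rewrite perturbed_quarter_turn -/N mx3_mul mx3_1.
  by congr mx3; rewrite ?mulfV ?mulrNN ?mulfV //; ring.
pose r : R := (1 / 3) ^+ (4 * N).
have fixe : word_mx (perturbed n) (common_line_word N (4 * N)) *m cv3 1 0 0 = r *: cv3 1 0 0.
  rewrite word_mx_common_line -/C -/y -/z -/Ci -!mulmxA.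
  have [v1 [v2 vE]] : exists v1 v2, z *m (Ci *m (y *m cv3 1 0 0)) = cv3 0 v1 v2.
    rewrite /z /y /perturbed (negPf i01) (negPf i02) eqxx eq_sym (negPf i12) rho0 CiE /pshear -/N.
    move: rho2_neq0; have [a [b [c [d [e [f [g [h [l ->]]]]]]]]] := mx3P (rho i2).
    rewrite !mxE /= mx3_tr => dg0; rewrite -!mulmxA !mx3_cv3.
    set v := (X in cv3 X _ _); suff -> : v = 0 by do 2!eexists.
    have e27 : 27%:R ^+ N = 9 ^+ N * 3 ^+ N :> R by rewrite -exprMn -natrM.
    have e3 : ((1 / 3) ^+ N)^-1 = 3 ^+ N :> R by rewrite -exprVn div1r invrK.
    rewrite /v e27 e3; have : 3 ^+ N != 0 :> R by rewrite expf_neq0 // pnatr_eq0.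
    by move: (9 ^+ N) (3 ^+ N) p9 => p q p0 q0; field; rewrite p0 q0 dg0.
  have turn : C ^+ (4 * N) *m cv3 0 v1 v2 = r *: cv3 0 v1 v2.
    rewrite /C perturbed_period -/N -/r mx3_cv3.
    by apply/colP; apply: ord3_ind; rewrite !mxE /=; ring.
  rewrite vE turn -vE -!scalemxAr mulKmx // (mulmxA (C ^+ N)) CCi mul1mx mulKmx //.
have f0 (A : 'M[R]_3) : A *m cv3 1 0 0 = r *: cv3 1 0 0 -> A o1 o0 = 0 /\ A o2 o0 = 0.
  have [a [b [c [d [e [f [g [h [l ->]]]]]]]]] := mx3P A; rewrite mx3_cv3 => E.
  have := congr1 (fun v : 'cV[R]_3 => v o1 0) E; have := congr1 (fun v : 'cV[R]_3 => v o2 0) E.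
  by rewrite !mxE /= => h1 h2; split; lra.
have [f1 f2] := f0 _ fixe.
apply: (@not_quasi_isometric_common_line _ _ i1 (4 * N) (9 ^+ (4 * N)) r _ sl _ _ _ _
  (perturbed_period n) f1 f2).
- by [].
- by rewrite expf_neq0 // pnatr_eq0.
- by rewrite expf_neq0 // lt0r_neq0 //; lra.
- rewrite /r -expr_div_n exprAC; apply: exprn_ile1; first exact: sqr_ge0.
  lra.
by move=> j; apply: common_line_word_reduced.
Qed.
End Perturbation.

(** * Zariski density *)

(** One induction serving two classes of functions: polynomials in matrix entries and Laurent
    polynomials in a parameter. *)
Lemma meval_closed (T : Type) (Cl : (T -> R) -> Prop) n (f : T -> 'I_n -> R) (p : mpoly.mpoly n R) :
  (forall u v, u =1 v -> Cl u -> Cl v) -> (forall c, Cl (fun=> c)) ->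
  (forall u v, Cl u -> Cl v -> Cl (fun t => u t + v t)) ->
  (forall u v, Cl u -> Cl v -> Cl (fun t => u t * v t)) ->
  (forall i, Cl (fun t => f t i)) -> Cl (fun t => mpoly.meval (f t) p).
Proof.
move=> ext cst add mul coord.
have expn u m : Cl u -> Cl (fun t => u t ^+ m).
  move=> Cu; elim: m => [|m IHm]; first by apply: ext (cst 1) => t; rewrite expr0.
  by apply: ext (mul _ _ Cu IHm) => t; rewrite exprS.
have prod (s : seq 'I_n) (m : 'I_n -> nat) : Cl (fun t => \prod_(i <- s) f t i ^+ m i).
  elim: s => [|i s IHs]; first by apply: ext (cst 1) => t; rewrite big_nil.
  by apply: ext (mul _ _ (expn _ (m i) (coord i)) IHs) => t; rewrite big_cons.
apply: (ext (fun t => \sum_(m <- mpoly.msupp p)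
     mpoly.mcoeff m p * \prod_i f t i ^+ mpoly.fun_of_multinom m i)).
  by move=> t; rewrite mpoly.mevalE.
elim: (mpoly.msupp p) => [|m s IHs]; first by apply: ext (cst 0) => t; rewrite big_nil.
apply: ext (add _ _ (mul _ _ (cst (mpoly.mcoeff m p)) (prod (index_enum _) (mpoly.fun_of_multinom m))) IHs).
by move=> t; rewrite big_cons.
Qed.

Lemma mx_coordsE (A : 'M[R]_3) (i j : 'I_3) :
  mx_coords A (mxvec_index i j : 'I_(3 * 3)) = A i j.
Proof. exact: mxvecE. Qed.

Definition polyfun (f : 'M[R]_3 -> R) : Prop :=
  exists p : mpoly.mpoly 9 R, forall A, f A = mpoly.meval (mx_coords A) p.

Lemma polyfun_entry (i j : 'I_3) : polyfun (fun A => A i j).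
Proof.
exists (mpoly.mpolyX R (mpoly.mnm1 (mxvec_index i j : 'I_(3 * 3)))) => A.
by rewrite mpoly.mevalXU mx_coordsE.
Qed.

Lemma polyfun_comp (F : 'M[R]_3 -> 'M[R]_3) (p : mpoly.mpoly 9 R) :
  (forall i j, polyfun (fun A => F A i j)) -> polyfun (fun A => mpoly.meval (mx_coords (F A)) p).
Proof.
move=> hF; apply: meval_closed.
- by move=> u v uv [q hq]; exists q => A; rewrite -uv.
- by move=> c; exists (mpoly.mpolyC 9 c) => A; rewrite mpoly.mevalC.
- by move=> u v [q hq] [q' hq']; exists (q + q') => A; rewrite mpoly.mevalD hq hq'.
- by move=> u v [q hq] [q' hq']; exists (q * q') => A; rewrite mpoly.mevalM hq hq'.
move=> l; case/mxvec_indexP: (l : 'I_(3 * 3)) => i j; have [q hq] := hF i j.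
by exists q => A; rewrite mx_coordsE.
Qed.

Lemma polyfunM f g : polyfun f -> polyfun g -> polyfun (fun A => f A * g A).
Proof. by move=> [q hq] [q' hq']; exists (q * q') => A; rewrite mpoly.mevalM hq hq'. Qed.

Lemma polyfunD f g : polyfun f -> polyfun g -> polyfun (fun A => f A + g A).
Proof. by move=> [q hq] [q' hq']; exists (q + q') => A; rewrite mpoly.mevalD hq hq'. Qed.

Lemma polyfun_cst c : polyfun (fun=> c).
Proof. by exists (mpoly.mpolyC 9 c) => A; rewrite mpoly.mevalC. Qed.

Lemma polyfun_ext f g : (forall A, f A = g A) -> polyfun f -> polyfun g.
Proof. by move=> fg [q hq]; exists q => A; rewrite -fg. Qed.

Lemma polyfun_mull B (i j : 'I_3) : polyfun (fun A => (B *m A) i j).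
Proof.
apply: (@polyfun_ext (fun A => B i o0 * A o0 j + B i o1 * A o1 j + B i o2 * A o2 j)).
  by move=> A; rewrite mxE sum_ord3.
by do ![apply: polyfunD|apply: polyfunM|exact: polyfun_cst|exact: polyfun_entry].
Qed.

Lemma polyfun_mulr B (i j : 'I_3) : polyfun (fun A => (A *m B) i j).
Proof.
apply: (@polyfun_ext (fun A => A i o0 * B o0 j + A i o1 * B o1 j + A i o2 * B o2 j)).
  by move=> A; rewrite mxE sum_ord3.
by do ![apply: polyfunD|apply: polyfunM|exact: polyfun_cst|exact: polyfun_entry].
Qed.

(** A power of [s] clears the denominator; values at 0 are left free. *)
Definition laurent (f : R -> R) : Prop :=
  exists (q : {poly R}) (d : nat), forall s, s != 0 -> s ^+ d * f s = q.[s].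

Lemma laurent_ext f g : f =1 g -> laurent f -> laurent g.
Proof. by move=> fg [q [d h]]; exists q, d => s s0; rewrite -fg h. Qed.

Lemma laurent_cst c : laurent (fun=> c).
Proof. by exists c%:P, 0%N => s _; rewrite expr0 mul1r hornerC. Qed.

Lemma laurent_id : laurent id.
Proof. by exists 'X, 0%N => s _; rewrite expr0 mul1r hornerX. Qed.

Lemma laurent_inv : laurent (fun s => s^-1).
Proof. by exists 1, 1%N => s s0; rewrite expr1 mulfV // hornerC. Qed.

Lemma laurentD f g : laurent f -> laurent g -> laurent (fun s => f s + g s).
Proof.
move=> [q [d h]] [q' [d' h']]; exists ('X ^+ d' * q + 'X ^+ d * q'), (d + d')%N => s s0.
by rewrite hornerD !hornerM !hornerXn -h // -h' // exprD; ring.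
Qed.

Lemma laurentM f g : laurent f -> laurent g -> laurent (fun s => f s * g s).
Proof.
move=> [q [d h]] [q' [d' h']]; exists (q * q'), (d + d')%N => s s0.
by rewrite hornerM -h // -h' // exprD; ring.
Qed.

Lemma laurent_eq0 f (u : nat -> R) : laurent f -> injective u -> (forall n, u n != 0) ->
  (forall n, f (u n) = 0) -> forall s, s != 0 -> f s = 0.
Proof.
move=> [q [d h]] inju u0 fu s s0.
have q0 : q = 0 by apply: (poly_eq0_inj inju) => n; rewrite -h // fu mulr0.
have := h s s0; rewrite q0 horner0 => /eqP; rewrite mulf_eq0 expf_eq0 (negPf s0) andbF /=.
by move/eqP.
Qed.

(** * Zariski closure of the image *)

Definition elem12 (r : R) := mx3 1 r 0 0 1 0 0 0 1.
Definition elem13 (r : R) := mx3 1 0 r 0 1 0 0 0 1.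
Definition elem21 (r : R) := mx3 1 0 0 r 1 0 0 0 1.
Definition elem23 (r : R) := mx3 1 0 0 0 1 r 0 0 1.
Definition elem31 (r : R) := mx3 1 0 0 0 1 0 r 0 1.
Definition elem32 (r : R) := mx3 1 0 0 0 1 0 0 r 1.

Section ZariskiClosure.
Variables (k : nat) (rho : 'I_k -> 'M[R]_3).
Hypothesis slrho : SL3rep rho.

Definition zclosure (A : 'M[R]_3) : Prop := forall p : mpoly.mpoly 9 R,
  (forall g : FG k, mpoly.meval (mx_coords (evalrep rho g)) p = 0) ->
  mpoly.meval (mx_coords A) p = 0.

Lemma zclosure_reduced_word w : reduced w -> zclosure (word_mx rho w).
Proof. by move=> rw p hp; have := hp (word rw). Qed.

(* A word need not be reduced to evaluate to an element of the image: cancel a letter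
   against the head of a reduced word. *)
Lemma word_mx_reduced w : exists2 w', reduced w' & word_mx rho w = word_mx rho w'.
Proof.
elim: w => [|x w [w' rw' e]]; first by exists [::].
rewrite word_mx_cons e; case: w' rw' {e} => [|y w'] rw'.
  by exists [:: x] => //; rewrite word_mx_cons.
case c : ((x.1 == y.1) && (x.2 != y.2)); last first.
  by exists [:: x, y & w']; rewrite ?word_mx_cons // /= c.
exists w'; first by case: w' rw' => //= z w' /andP [].
rewrite word_mx_cons mulmxA.
have -> : letter_mx rho x *m letter_mx rho y = 1%:M; last by rewrite mul1mx.
case: x y c {rw'} => i s [j t] /= /andP [/eqP <- st]; rewrite /letter_mx /=.
have u := unitmx_rep i slrho.
by case: s t st => [] [] //= _; rewrite ?mulVmx ?mulmxV.
Qed.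

Lemma zclosure_word w : zclosure (word_mx rho w).
Proof. by have [w' rw' ->] := word_mx_reduced w; exact: zclosure_reduced_word. Qed.

Lemma evalrep_word_mx (g : FG k) : evalrep rho g = word_mx rho (sval g).
Proof. by []. Qed.

(** Translations are polynomial maps: first fix a left factor in the image and let the right one
    pass to the closure, then fix [B] and vary the left factor. *)
Lemma zclosureM A B : zclosure A -> zclosure B -> zclosure (A *m B).
Proof.
move=> zA zB p hp.
have left (g : FG k) : mpoly.meval (mx_coords (evalrep rho g *m B)) p = 0.
  have [q hq] := polyfun_comp p (polyfun_mull (evalrep rho g)).
  rewrite hq; apply: zB => g'; rewrite -hq !evalrep_word_mx -word_mx_cat.
  by apply: zclosure_word => h; exact: hp.
have [q hq] := polyfun_comp p (polyfun_mulr B).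
by rewrite hq; apply: zA => g; rewrite -hq.
Qed.

(** A polynomial vanishing on the closure pulls back to a Laurent polynomial with infinitely many
    zeros. *)
Lemma zclosure_laurent (F : R -> 'M[R]_3) (u : nat -> R) :
  (forall i j, laurent (fun s => F s i j)) -> injective u -> (forall n, u n != 0) ->
  (forall n, zclosure (F (u n))) -> forall s, s != 0 -> zclosure (F s).
Proof.
move=> lF inju u0 zu s s0 p hp.
apply: (@laurent_eq0 (fun s => mpoly.meval (mx_coords (F s)) p) u) => // [|n]; last exact: zu.
apply: meval_closed; [exact: laurent_ext|exact: laurent_cst|exact: laurentD|exact: laurentM|].
move=> l; case/mxvec_indexP: (l : 'I_(3 * 3)) => i j.
by apply: laurent_ext (lF i j) => t; rewrite mx_coordsE.
Qed.

Section Elementary.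
Hypotheses (z12 : forall r, zclosure (elem12 r)) (z13 : forall r, zclosure (elem13 r))
  (z21 : forall r, zclosure (elem21 r)) (z23 : forall r, zclosure (elem23 r))
  (z31 : forall r, zclosure (elem31 r)) (z32 : forall r, zclosure (elem32 r)).

Lemma zclosure_block p q r t : p * t - q * r = 1 -> zclosure (mx3 1 0 0 0 p q 0 r t).
Proof.
have gen p' q' r' t' : r' != 0 -> p' * t' - q' * r' = 1 -> zclosure (mx3 1 0 0 0 p' q' 0 r' t').
  move=> r0 d; have -> : mx3 1 0 0 0 p' q' 0 r' t' =
      elem23 ((p' - 1) / r') *m (elem32 r' *m elem23 ((t' - 1) / r')).
    rewrite !mx3_mul; congr mx3; try by field.
    have -> : q' = (p' * t' - 1) / r' by rewrite -d; field.
    by field.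
  by do ![apply: zclosureM].
(* If [r = 0] then [p] is nonzero, and a row operation puts it in the place of [r]. *)
move=> d; have [r0|r0] := eqVneq r 0; last exact: gen.
have -> : mx3 1 0 0 0 p q 0 r t = elem32 (-1) *m mx3 1 0 0 0 p q 0 (r + p) (t + q).
  by rewrite mx3_mul; congr mx3; ring.
apply: zclosureM => //; apply: gen; last by rewrite -d; ring.
by rewrite r0 add0r; apply/eqP => p0; move: d; rewrite p0 r0 mulr0 mul0r subrr => /eqP; rewrite eq_sym oner_eq0.
Qed.

(** Gaussian elimination: a nonzero entry below the corner turns the corner into 1, and clearing its
    row and column leaves an SL_2 block. *)
Lemma zclosure_SL3 A : \det A = 1 -> zclosure A.
Proof.
have head1 b c d e f g h i : \det (mx3 1 b c d e f g h i) = 1 -> zclosure (mx3 1 b c d e f g h i).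
  rewrite mx3_det => dt.
  have -> : mx3 1 b c d e f g h i = elem21 d *m (elem31 g *m
     (mx3 1 0 0 0 (e - d * b) (f - d * c) 0 (h - g * b) (i - g * c) *m (elem12 b *m elem13 c))).
    by rewrite !mx3_mul; congr mx3; ring.
  by do ![apply: zclosureM => //]; apply: zclosure_block; rewrite -dt; ring.
have headd a b c d e f g h i : d != 0 -> \det (mx3 a b c d e f g h i) = 1 ->
    zclosure (mx3 a b c d e f g h i).
  move=> d0; rewrite mx3_det => dt.
  have -> : mx3 a b c d e f g h i = elem12 ((a - 1) / d) *m
      mx3 1 (b + (1 - a) / d * e) (c + (1 - a) / d * f) d e f g h i.
    by rewrite mx3_mul; congr mx3; field.
  by apply: zclosureM => //; apply: head1; rewrite mx3_det -dt; field.
have [a [b [c [d [e [f [g [h [i ->]]]]]]]]] := mx3P A.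
have [d0|d0] := eqVneq d 0; last exact: headd.
have [g0|g0] := eqVneq g 0; last first.
  rewrite mx3_det => dt.
  have -> : mx3 a b c d e f g h i = elem13 ((a - 1) / g) *m
      mx3 1 (b + (1 - a) / g * h) (c + (1 - a) / g * i) d e f g h i.
    by rewrite mx3_mul; congr mx3; field.
  by apply: zclosureM => //; apply: head1; rewrite mx3_det -dt; field.
rewrite mx3_det => dt.
have -> : mx3 a b c d e f g h i = elem21 (-1) *m mx3 a b c (d + a) (e + b) (f + c) g h i.
  by rewrite mx3_mul; congr mx3; ring.
apply: zclosureM => //; apply: headd; last by rewrite mx3_det -dt; ring.
rewrite d0 add0r; apply/eqP => a0; suff : 0 = 1 :> R by move/eqP; rewrite eq_sym oner_eq0.
by rewrite -[RHS]dt a0 d0 g0; ring.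
Qed.
End Elementary.
End ZariskiClosure.

Lemma laurentX f n : laurent f -> laurent (fun s => f s ^+ n).
Proof.
move=> lf; elim: n => [|n IHn]; first by apply: laurent_ext (laurent_cst 1) => s; rewrite expr0.
by apply: laurent_ext (laurentM lf IHn) => s; rewrite exprS.
Qed.

Lemma laurentN f : laurent f -> laurent (fun s => - f s).
Proof. by move=> lf; apply: laurent_ext (laurentM (laurent_cst (-1)) lf) => s; rewrite mulN1r. Qed.

Ltac laurent_tac := repeat first [exact: laurent_cst | exact: laurent_id | exact: laurent_inv
  | apply: laurentX | apply: laurentN | apply: laurentD | apply: laurentM].

Lemma laurent_mx3 (a b c d e f g h i : R -> R) : laurent a -> laurent b -> laurent c ->
  laurent d -> laurent e -> laurent f -> laurent g -> laurent h -> laurent i ->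
  forall r s, laurent (fun t => mx3 (a t) (b t) (c t) (d t) (e t) (f t) (g t) (h t) (i t) r s).
Proof.
move=> h1 h2 h3 h4 h5 h6 h7 h8 h9; do 2![apply: ord3_ind];
  match goal with H : laurent ?u |- _ => by apply: (laurent_ext _ H) => t; rewrite mxE end.
Qed.

Lemma exprn_inj (x : R) : 1 < x -> injective (fun n : nat => x ^+ n).
Proof. by move=> x1; apply: ieexprIn; [lra|rewrite gt_eqF]. Qed.

(** * Tori and unipotents in the closure *)

Section Density.
Variables (k : nat) (i1 i2 : 'I_k) (rho : 'I_k -> 'M[R]_3) (nu S : R).
Hypotheses (slrho : SL3rep rho) (nu1 : 1 < nu) (S2 : S ^+ 2 = 3 / 4).
Hypothesis rot3 : forall n, rotdil 9 (1 / 3) S ^+ (3 * n) =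
  mx3 (729%:R ^+ n) 0 0 0 (27%:R ^- n) 0 0 0 (27%:R ^- n).
Hypothesis rho1 : rho i1 = rotdil 9 (1 / 3) S.
Hypothesis rho2 : rho i2 = boost nu *m rotdil 9 (1 / 3) S *m boost nu^-1.

Notation Z := (zclosure rho).

Let ch := (nu + nu^-1) / 2.
Let sh := (nu - nu^-1) / 2.

Let nu_gt0 : 0 < nu. Proof. exact: lt_trans ltr01 nu1. Qed.

Let nu_neq0 : nu != 0. Proof. exact: lt0r_neq0. Qed.

Let ch2_sh2 : ch ^+ 2 - sh ^+ 2 = 1. Proof. by rewrite /ch /sh; field. Qed.

Let chsh_neq0 : ch * sh != 0.
Proof.
have nu1' := nu1; have nui : nu^-1 < 1 by rewrite invf_lt1.
have nui0 : 0 < nu^-1 by rewrite invr_gt0.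
by apply: lt0r_neq0; apply: mulr_gt0; rewrite /ch /sh; lra.
Qed.

(** The matrix diag(s^2, s^(-1), s^(-1)) conjugated by [boost nu] and then by diag(tau, 1, 1). *)
Definition boosted_torus (tau s : R) : 'M[R]_3 :=
  mx3 (s ^+ 2 * ch ^+ 2 - s^-1 * sh ^+ 2) (tau * (ch * sh * (s^-1 - s ^+ 2))) 0
      (tau^-1 * (ch * sh * (s ^+ 2 - s^-1))) (s^-1 * ch ^+ 2 - s ^+ 2 * sh ^+ 2) 0
      0 0 s^-1.

Let zX i n s : Z (letter_mx rho (i, s) ^+ n).
Proof. by rewrite -word_mx_nseq; exact: zclosure_word. Qed.

Lemma zclosure_torus n : Z (boosted_torus 1 (27%:R ^+ n)).
Proof.
have -> : boosted_torus 1 (27%:R ^+ n) = letter_mx rho (i2, false) ^+ (3 * n).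
  have conj m : letter_mx rho (i2, false) ^+ m = boost nu *m rotdil 9 (1 / 3) S ^+ m *m boost nu^-1.
    elim: m => [|m IHm]; first by rewrite !expr0 mulmx1 boostK.
    rewrite exprS IHm /letter_mx /= rho2 exprS -!mulmxE -!mulmxA.
    by rewrite (mulmxA (boost nu^-1)) boostVK // mul1mx.
  rewrite conj rot3 /boosted_torus /boost !mx3_mul invrK.
  have -> : 729%:R ^+ n = (27%:R ^+ n) ^+ 2 :> R by rewrite exprAC; congr (_ ^+ n); ring.
  move: (27%:R ^+ n) => s.
  by rewrite /ch /sh; congr mx3; rewrite ?invr1; ring.
exact: zX.
Qed.

Lemma zclosure_boosted_torus1 s : s != 0 -> Z (boosted_torus 1 s).
Proof.
apply: (@zclosure_laurent _ _ _ (fun n => 27%:R ^+ n)).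
- by rewrite /boosted_torus; apply: laurent_mx3; laurent_tac.
- by apply: exprn_inj; rewrite ltr1n.
- by move=> n; rewrite expf_neq0 // pnatr_eq0.
- exact: zclosure_torus.
Qed.

Lemma zclosure_boosted_torus tau s : tau != 0 -> s != 0 -> Z (boosted_torus tau s).
Proof.
move=> tau0 s0; move: tau tau0.
(* Conjugating by the 3n-th power of [rho i1] multiplies [tau] by the ratio of its eigenvalues,
   [729 ^+ n * 27 ^+ n]. *)
apply: (@zclosure_laurent _ _ (fun tau => boosted_torus tau s) (fun n => (729 * 27)%:R ^+ n)).
- by rewrite /boosted_torus; apply: laurent_mx3; laurent_tac.
- by apply: exprn_inj; rewrite ltr1n.
- by move=> n; rewrite expf_neq0 // pnatr_eq0.
move=> n.
have -> : boosted_torus ((729 * 27)%:R ^+ n) s = letter_mx rho (i1, false) ^+ (3 * n) *m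
    boosted_torus 1 s *m letter_mx rho (i1, true) ^+ (3 * n).
  have p0 : 729%:R ^+ n != 0 :> R by rewrite expf_neq0 // pnatr_eq0.
  have q0 : 27%:R ^+ n != 0 :> R by rewrite expf_neq0 // pnatr_eq0.
  have e : letter_mx rho (i1, false) ^+ (3 * n) =
      mx3 (729%:R ^+ n) 0 0 0 (27%:R ^- n) 0 0 0 (27%:R ^- n) by rewrite /letter_mx /= rho1 rot3.
  have -> : letter_mx rho (i1, true) ^+ (3 * n) =
      mx3 (729%:R ^- n) 0 0 0 (27%:R ^+ n) 0 0 0 (27%:R ^+ n).
    rewrite /letter_mx /=; have u := unitmx_rep i1 slrho.
    rewrite -[LHS]mulmx1 [X in _ *m X](_ : _ = letter_mx rho (i1, false) ^+ (3 * n) *m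
      mx3 (729%:R ^- n) 0 0 0 (27%:R ^+ n) 0 0 0 (27%:R ^+ n)).
      rewrite mulmxA /letter_mx /= mulmxE -exprMn_comm.
        by rewrite -mulmxE mulVmx // expr1n mulmxE mul1r.
      by rewrite /GRing.comm -!mulmxE mulVmx // mulmxV.
    by rewrite e mx3_mul mx3_1; congr mx3; rewrite ?mulfV ?mulVf //; ring.
  rewrite e natrM exprMn; move: (729%:R ^+ n) (27%:R ^+ n) p0 q0 => p q p0 q0.
  rewrite /boosted_torus !mx3_mul invr1 !mul1r invfM.
  by congr mx3; field; rewrite ?p0 ?q0 ?s0.
by do ![apply: zclosureM => //]; first [exact: zX|exact: zclosure_boosted_torus1].
Qed.

(* The entries of [boosted_torus (r / (s ^ 3 - 1)) s] are Laurent polynomials in [s], and at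
   [s = 1] that matrix is unipotent. *)
Lemma zclosure_elem12 x : Z (elem12 x).
Proof.
have [->|x0] := eqVneq x 0.
  by have := zclosure_word slrho [::]; rewrite word_mx_nil mx3_1.
pose r := - x / (ch * sh); have r0 : r != 0 by rewrite mulf_neq0 ?oppr_eq0 ?invr_eq0.
pose F s := mx3 (s ^+ 2 * ch ^+ 2 - s^-1 * sh ^+ 2) (- r * (ch * sh) * s^-1) 0
   (r^-1 * (ch * sh) * (s ^+ 3 - 1) ^+ 2 * s^-1) (s^-1 * ch ^+ 2 - s ^+ 2 * sh ^+ 2) 0 0 0 s^-1.
have -> : elem12 x = F 1.
  rewrite /F invr1 !expr1n subrr expr0n /= !mul1r !mulr1 mulr0 ch2_sh2; congr mx3.
  by rewrite /r !mulNr opprK divfK.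
(* The exponent starts at 1 to avoid the sample [s = 1], where the denominator of [tau] vanishes. *)
apply: (@zclosure_laurent _ _ F (fun n => 2 ^+ n.+1)).
- by rewrite /F; apply: laurent_mx3; laurent_tac.
- have two1 : 1 < 2 :> R by rewrite ltr1n.
  by move=> m n h; apply: succn_inj; exact: (exprn_inj two1 h).
- by move=> n; rewrite expf_neq0 // pnatr_eq0.
- move=> n; have s1 : 1 < 2 ^+ n.+1 :> R by rewrite exprn_egt1 // ltr1n.
  move: (2 ^+ n.+1) s1 => s s1; have s0 : s != 0 by rewrite lt0r_neq0 //; lra.
  have s3 : s ^+ 3 - 1 != 0 by rewrite lt0r_neq0 // subr_gt0 exprn_egt1.
  have -> : F s = boosted_torus (r / (s ^+ 3 - 1)) s.
    by rewrite /F /boosted_torus; congr mx3; field; rewrite ?s0 ?s3 ?r0.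
  by apply: zclosure_boosted_torus => //; rewrite mulf_neq0 ?invr_eq0.
exact: oner_neq0.
Qed.

(** As for [zclosure_elem12] with the inverse [tau], so that the entry above the diagonal vanishes
    at [s = 1]. *)
Lemma zclosure_elem21 x : Z (elem21 x).
Proof.
have [->|x0] := eqVneq x 0.
  by have := zclosure_word slrho [::]; rewrite word_mx_nil mx3_1.
pose r := x / (ch * sh); have r0 : r != 0 by rewrite mulf_neq0 ?invr_eq0.
pose F s := mx3 (s ^+ 2 * ch ^+ 2 - s^-1 * sh ^+ 2)
   (- r^-1 * (ch * sh) * (s ^+ 3 - 1) ^+ 2 * s^-1) 0
   (r * (ch * sh) * s^-1) (s^-1 * ch ^+ 2 - s ^+ 2 * sh ^+ 2) 0 0 0 s^-1.
have -> : elem21 x = F 1.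
  rewrite /F invr1 !expr1n subrr expr0n /= !mul1r !mulr1 mulr0 ch2_sh2; congr mx3.
  by rewrite /r divfK.
apply: (@zclosure_laurent _ _ F (fun n => 2 ^+ n.+1)).
- by rewrite /F; apply: laurent_mx3; laurent_tac.
- have two1 : 1 < 2 :> R by rewrite ltr1n.
  by move=> m n h; apply: succn_inj; exact: (exprn_inj two1 h).
- by move=> n; rewrite expf_neq0 // pnatr_eq0.
- move=> n; have s1 : 1 < 2 ^+ n.+1 :> R by rewrite exprn_egt1 // ltr1n.
  move: (2 ^+ n.+1) s1 => s s1; have s0 : s != 0 by rewrite lt0r_neq0 //; lra.
  have s3 : s ^+ 3 - 1 != 0 by rewrite lt0r_neq0 // subr_gt0 exprn_egt1.
  have -> : F s = boosted_torus ((s ^+ 3 - 1) / r) s.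
    by rewrite /F /boosted_torus; congr mx3; field; rewrite ?s0 ?s3 ?r0.
  by apply: zclosure_boosted_torus => //; rewrite mulf_neq0 ?invr_eq0.
exact: oner_neq0.
Qed.

Let S_neq0 : S != 0.
Proof. by apply/eqP => S0; move: S2; rewrite S0 expr0n /=; lra. Qed.

Let zc : Z (rotdil 9 (1 / 3) S).
Proof. by rewrite -rho1; have := zX i1 1 false; rewrite expr1. Qed.

Let zci : Z (rotdil (1 / 9) 3 (- S)).
Proof.
by rewrite -(invmx_eq (rotdil_inv S2)) -rho1; have := zX i1 1 true; rewrite expr1.
Qed.

(** Conjugation by [rho i1] rotates the row of the unipotent: the result has entries [- 27 / 2 * r]
    and [27 * r * S] in its first row, and the last factor removes the former. *)
Lemma zclosure_elem13 x : Z (elem13 x).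
Proof.
pose r := x / (27 * S).
have xE : x = 27 * r * S by rewrite /r; field.
have SS : S * S = 3 / 4 by rewrite -expr2.
have -> : elem13 x = rotdil 9 (1 / 3) S *m elem12 r *m rotdil (1 / 9) 3 (- S) *m
    elem12 (27 / 2 * r).
  by move: r xE => r ->; rewrite !mx3_mul; congr mx3; lra.
by do ![apply: zclosureM => //]; exact: zclosure_elem12.
Qed.

(** The same with columns: conjugation produces [- r / 54] and [r * S / 27]. *)
Lemma zclosure_elem31 x : Z (elem31 x).
Proof.
pose r := 27 * x / S.
have xE : x = r * S / 27 by rewrite /r; field.
have SS : S * S = 3 / 4 by rewrite -expr2.
have -> : elem31 x = rotdil 9 (1 / 3) S *m elem21 r *m rotdil (1 / 9) 3 (- S) *m
    elem21 (r / 54).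
  move: r xE => r ->; have rSS : r * (S * S) = r * (3 / 4) by rewrite SS.
  by rewrite !mx3_mul; congr mx3; lra.
by do ![apply: zclosureM => //]; exact: zclosure_elem21.
Qed.

(** A commutator of two elementary matrices. *)
Lemma zclosure_elem23 x : Z (elem23 x).
Proof.
have -> : elem23 x = elem21 x *m elem13 1 *m elem21 (- x) *m elem13 (-1).
  by rewrite !mx3_mul; congr mx3; ring.
by do ![apply: zclosureM => //]; 
  first [exact: zclosure_elem13|exact: zclosure_elem21].
Qed.

Lemma zclosure_elem32 x : Z (elem32 x).
Proof.
have -> : elem32 x = elem31 x *m elem12 1 *m elem31 (- x) *m elem12 (-1).
  by rewrite !mx3_mul; congr mx3; ring.
by do ![apply: zclosureM => //]; first [exact: zclosure_elem12|exact: zclosure_elem31].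
Qed.

Lemma zariski_dense : zariski_dense_image rho.
Proof.
move=> p hp A dA; apply: (zclosure_SL3 slrho _ _ _ _ _ _ dA) => //.
- exact: zclosure_elem12.
- exact: zclosure_elem13.
- exact: zclosure_elem21.
- exact: zclosure_elem23.
- exact: zclosure_elem31.
- exact: zclosure_elem32.
Qed.
End Density.

(** * The representation *)

Lemma tr_boost q : (boost q)^T = boost q. Proof. exact: mx3_tr. Qed.

Lemma tr_rotdil p q T : (rotdil p q T)^T = rotdil p q (- T).
Proof. by rewrite mx3_tr; congr mx3; ring. Qed.

Lemma det_boost q : q != 0 -> \det (boost q) = 1.
Proof. by move=> q0; rewrite mx3_det; field. Qed.

Lemma det_rotdil T : T ^+ 2 = 3 / 4 -> \det (rotdil 9 (1 / 3) T) = 1.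
Proof. by move=> TT; rewrite mx3_det; lra. Qed.

Lemma far_ratio (i j : nat) : i != j -> far ((100 ^+ j / 100) / (100 ^+ i / 100)).
Proof.
have h0 : 0 < 100 :> R by rewrite ltr0n.
have step n : 100 <= 100 ^+ n.+1 :> R.
  by rewrite exprS -[X in X <= _]mulr1 ler_pM2l // exprn_ege1 // ler1n.
have key (a b : nat) : (a < b)%N -> exists2 t : R, 100 <= t & (100 : R) ^+ b = t * 100 ^+ a.
  move=> ab; exists (100 ^+ (b - a)); first by rewrite -(@prednK (b - a)) ?subn_gt0.
  by rewrite -exprD subnK // ltnW.
have pw n : 0 < 100 ^+ n :> R by exact: exprn_gt0.
have cancel a b : (100 ^+ b / 100) / (100 ^+ a / 100) = 100 ^+ b / 100 ^+ a :> R.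
  by field; rewrite !lt0r_neq0.
rewrite cancel neq_ltn => /orP [/key [t t1 ->]|/key [t t1 ->]].
  by left; rewrite mulfK ?lt0r_neq0.
right; rewrite invfM mulrCA mulfV ?lt0r_neq0 // mulr1.
have t0 : 0 < t by lra.
by rewrite invr_gt0 t0 div1r lef_pV2 ?posrE.
Qed.

Theorem mainTheorem2 (k : nat) (hk : (2 < k)%N) :
  exists rho : 'I_k -> 'M[Rdefinitions.R]_3,
    [/\ SL3rep rho,
        quasi_isometric rho,
        zariski_dense_image rho,
        ~ in_closure (@anosov k) rho &
        ~ robust (@quasi_isometric k) rho].
Proof.
pose i0 : 'I_k := Ordinal (ltn_trans (isT : 0 < 2)%N hk).
pose i1 : 'I_k := Ordinal (ltn_trans (isT : 1 < 2)%N hk).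
pose i2 : 'I_k := Ordinal hk.
pose S := sin (2 * (PI / 3)); have S2 : S ^+ 2 = 3 / 4 := sin_two_thirds_pi.
(* Dividing by 100 gives index 1 the trivial boost, and index 0 the inverse of the boost of index
   2. *)
pose lam (i : 'I_k) : R := 100 ^+ i / 100.
(* Transposition inverts the rotation; with the inverse boost this makes [rho i0] the transpose of
   [rho i2]. *)
pose Tw (i : 'I_k) : R := if i == i0 then - S else S.
have pw n : 0 < 100 ^+ n :> R by rewrite exprn_gt0 // ltr0n.
have lam0 i : 0 < lam i by rewrite divr_gt0 // ltr0n.
have Tw2 i : Tw i ^+ 2 = 3 / 4 by rewrite /Tw; case: eqP; rewrite ?sqrrN.
have lam1 : lam i1 = 1 by rewrite /lam /= expr1 divff // pnatr_eq0.
have lam2 : lam i2 = 100 by rewrite /lam /= expr2 mulfK // pnatr_eq0.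
have lamfar i j : i != j -> far (lam j / lam i) by move=> ij; exact: far_ratio.
have fl i : lam i = 1 \/ far (lam i).
  have [->|ne] := eqVneq i i1; [by left|right].
  by rewrite -[lam i]divr1 -lam1; apply: lamfar; rewrite eq_sym.
pose rho := schottky lam Tw.
have sl : SL3rep rho.
  by move=> i; rewrite /rho /schottky !det_mulmx !det_boost ?det_rotdil ?invr_eq0 ?lt0r_neq0 // !mulr1.
have rho1 : rho i1 = rotdil 9 (1 / 3) S.
  by rewrite /rho /schottky lam1 invr1 boost1 mulmx1 mul1mx.
have rho2 : rho i2 = boost 100 *m rotdil 9 (1 / 3) S *m boost 100^-1.
  by rewrite /rho /schottky lam2.
have rho0 : rho i0 = (rho i2)^T.
  rewrite rho2 !trmx_mul !tr_boost tr_rotdil mulmxA /rho /schottky.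
  have -> : Tw i0 = - S by rewrite /Tw eqxx.
  by rewrite /lam /= expr0 div1r invrK.
have S0 : S != 0 by apply/eqP => z; move: S2; rewrite z expr0n /=; lra.
exists rho; split => //.
(* A bound on all boosts, uniform in the generator, provides the constant [K] of the growth
   estimate. *)
- have lamB i : lam i <= 100 ^+ k.
    rewrite ler_pdivrMr ?ltr0n // -exprSr.
    by rewrite ler_weXn2l ?ler1n // leqW // ltnW // ltn_ord.
  apply: (@schottky_quasi_isometric _ _ _ lam0 Tw2 lamfar ((100 ^+ k)^-1 ^+ 2)) => //.
  + by rewrite exprn_gt0 // invr_gt0.
  + move=> i; have h : (100 ^+ k)^-1 ^+ 2 <= (lam i)^-1 ^+ 2.
      by apply: lerXn2r; rewrite ?nnegrE ?invr_ge0 ?(ltW (pw k)) ?(ltW (lam0 i)) // lef_pV2 ?posrE.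
    by have := sqr_ge0 (lam i)^-1; lra.
  + have h : (100 ^+ k)^-1 ^+ 2 <= 1 :> R.
      by rewrite exprn_ile1 ?invr_ge0 ?(ltW (pw k)) // invf_le1 // exprn_ege1 // ler1n.
    lra.
- apply: (@zariski_dense _ i1 i2 rho 100 S sl _ S2 _ rho1 rho2); first by rewrite ltr1n.
  move=> n; rewrite -loxo_two_thirds_pi loxoX /loxo.
  have -> : (3 * n)%:R * (2 * (PI / 3)) = 0 + 2 * n%:R * PI by rewrite natrM; field.
  rewrite cos_periodR sin_periodR cos_0R sin_0R !mulr0 oppr0 !mulr1 !(exprM _ 3).
  have -> : 9 ^+ 3 = 729%:R :> R by ring.
  have -> : (1 / 3) ^+ 3 = 27%:R^-1 :> R by field.
  by rewrite exprVn.
- apply: (@not_in_closure_anosov _ _ i1 sl).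
  + by rewrite rho1 mx3_trace; lra.
  + by rewrite rho1 (invmx_eq (rotdil_inv S2)) mx3_trace; lra.
apply: (@not_robust_sequence _ _ (perturbed i1 i2 rho)) => //.
- exact: perturbed_SL3.
- by apply: tends_perturbed; rewrite rho1 loxo_two_thirds_pi.
move=> n; apply: (@perturbed_not_quasi_isometric _ i0 i1 i2 rho) => //.
(* The denominator of [pshear] is nonzero because this entry is. *)
have -> : rho i2 o2 o0 = S * ((100^-1 - 100) / 6).
  by rewrite rho2 !mx3_mul mxE /= invrK; field.
apply: lt0r_neq0; apply: ltr_wpDl; first exact: sqr_ge0.
rewrite exprn_even_gt0 //= mulf_neq0 // lt_eqF //.
have : 100^-1 < 1 :> R by rewrite invf_lt1 ?ltr1n ?ltr0n.
by lra.
Qed.
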